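(* Let $G$ be a graph with $n$ vertices that is not 2-paintable. Then $M(G)=n+1$ if and only if one of the following holds: $G$ is $K_{2,4}$; or $G$ is a 4-vertex graph containing $C_3$ as a subgraph; or the core of $G$ is an odd cycle $C_{n-1}$ with $n-1$ vertices.
   Context: All graphs are finite and simple. Let $f:V(G)\to\mathbb{Z}_{\ge 0}$. The game $(G,f)$ is played by Lister and Painter. In round $i$ Lister chooses, adaptively, a nonempty set $V_i\subseteq V(G)$ of marked vertices, and then Painter, seeing $V_1,\dots,V_i$, chooses an independent set $X_i\subseteq V_i$ whose vertices receive color $i$. A vertex that has been colored needs no further coloring, but may still be marked later. Painter wins if at the end every vertex has been colored. In the game with exactly $t$ rounds ($t$ is known to both players in advance), Lister must choose $V_1,\dots,V_t$ so that each vertex $v$ lies in exactly $f(v)$ of them; $G$ is $[f,t]$-paintable if Painter has a winning strategy in this game (vacuously true if no legal sequence of marked sets of length $t$ exists). In the unrestricted game the number of rounds is not fixed in advance and play continues until every vertex $v$ has been marked $f(v)$ times (never more); $G$ is $f$-paintable if Painter has a winning strategy in the unrestricted game. For the constant function $f\equiv k$ we say $k$-paintable and $[k,t]$-paintable. $M(G)$ is the maximum $t$ such that $G$ is not $[2,t]$-paintable. The core of $G$ is the subgraph obtained by iteratively removing all vertices of degree 1. $C_k$ is the cycle with $k$ vertices, and $K_{2,4}$ is the complete bipartite graph with parts of sizes 2 and 4.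
   Formalization: The core is obtained by iteratively removing vertices of degree at most 1, so isolated vertices too; with degree exactly 1 the claim fails for the disjoint union of C_5 and a single vertex, where n = 6 and M(G) = 7. *)

(* Defs.v *)
From mathcomp Require Import all_boot.

Set Implicit Arguments.
Unset Strict Implicit.
Unset Printing Implicit Defensive.

(* A finite simple graph is a finType T of vertices together with a symmetric
   irreflexive adjacency relation e : rel T. *)

Section Graphs.

Variables (T1 T2 : finType).

Definition graph_iso (e1 : rel T1) (e2 : rel T2) : Prop :=
  exists2 h : T1 -> T2, bijective h & {mono h : x y / e1 x y >-> e2 x y}.

Definition is_subgraph (e1 : rel T1) (e2 : rel T2) : Prop :=
  exists2 h : T1 -> T2, injective h & {homo h : x y / e1 x y >-> e2 x y}.

End Graphs.

(* ordS is the cyclic successor on 'I_k, so this is C_k for 3 <= k only. *)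
Definition cycle_graph (k : nat) : rel 'I_k :=
  fun i j => (ordS i == j) || (ordS j == i).

Definition complete_bipartite (p q : nat) : rel ('I_p + 'I_q)%type :=
  fun x y => match x, y with
             | inl _, inr _ | inr _, inl _ => true
             | _, _ => false
             end.

Section Core.

Variables (T : finType) (e : rel T).

Definition induced (S : {set T}) : rel {x : T | x \in S} :=
  fun x y => e (val x) (val y).

Definition deg_in (S : {set T}) (v : T) : nat := #|[set w in S | e v w]|.

(* Vertices of degree 0 are discarded together with those of degree 1.  This
   makes the core a well-defined vertex set, whatever the order of removal.  On
   a connected graph with a cycle no vertex of degree 0 ever appears, and this
   is the result of removing vertices of degree 1 only.  Isolated vertices have to
   go: the disjoint union of C_5 and one vertex is not 2-paintable and its M is
   7, i.e. its number of vertices plus 1.  #|T| iterations are enough to reach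
   a fixpoint. *)
Definition core : {set T} :=
  iter #|T| (fun S : {set T} => [set v in S | 1 < deg_in S v]) [set: T].

End Core.

Section Game.

Variables (T : finType) (e : rel T).

Definition independent (X : {set T}) : Prop := {in X &, forall x y, ~~ e x y}.

(* A Painter strategy maps the history [:: V_1; ...; V_i] to X_i.  As it is
   deterministic, the plays of an adaptive Lister against it are exactly the
   sequences of marked sets. *)
Definition valid_strategy (S : seq {set T} -> {set T}) : Prop :=
  forall (Vs : seq {set T}) (V : {set T}),
    S (rcons Vs V) \subset V /\ independent (S (rcons Vs V)).

Definition legal (f : T -> nat) (Vs : seq {set T}) : Prop :=
  (forall V, V \in Vs -> V != set0) /\
  (forall v, count (fun V : {set T} => v \in V) Vs = f v).

Definition all_colored (S : seq {set T} -> {set T}) (Vs : seq {set T}) : Prop :=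
  forall v, exists2 i, i < size Vs & v \in S (take i.+1 Vs).

Definition paintable (f : T -> nat) : Prop :=
  exists2 S, valid_strategy S &
    forall Vs, legal f Vs -> all_colored S Vs.

(* The strategy may depend on t, which is known in advance. *)
Definition paintable_in (f : T -> nat) (t : nat) : Prop :=
  exists2 S, valid_strategy S &
    forall Vs, size Vs = t -> legal f Vs -> all_colored S Vs.

(* M(G) = m *)
Definition is_M (m : nat) : Prop :=
  ~ paintable_in (fun=> 2) m /\
  forall t, ~ paintable_in (fun=> 2) t -> t <= m.

End Game.

(* Main.v *)
Require Import Defs.
From mathcomp Require Import all_boot.
From mathcomp Require Import boolp zify.

Set Implicit Arguments.
Unset Strict Implicit.
Unset Printing Implicit Defensive.

(** A round that marks [V] spends [#|V|] tokens, so in a play of exactly [t]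
    rounds in which each of the [n] vertices is marked twice the excesses
    [#|V| - 1] add up to [2 n - t].  Asking for many rounds is thus giving Lister
    a small budget for marking vertices simultaneously.  The game with such a
    budget [b] is [lister_wins b], and [is_M e n.+1] says that Lister wins with
    budget [n - 1] but not with budget [n - 2] ([is_M_budget]).  Deleting a vertex
    changes [n] and leaves Lister's strategies on the rest intact, so the question
    is which minimal obstructions are cheap compared with the number of vertices.

    Odd cycles.  On an odd cycle of length [k] Lister marks everything and then
    an edge that was left uncoloured, for [k] in total ([lister_odd_cycle]), and
    this is optimal ([painter_odd_cycle]).  So a shortest odd cycle [D] of a graph
    with [M = n + 1] misses exactly one vertex [w].  If [w] has at most one
    neighbour, [D] is the core.  If [w] has two, they form a theta graph with [D],
    on which budget [n - 2] suffices unless [n = 4] ([lister_theta]).  Conversely a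
    vertex of degree at most one does not help Lister ([painter_peel]), and budget 2
    never suffices ([painter_budget2]), which settles the graphs with four vertices.

    No odd cycles.  The basic weapon is to mark the two ends of an edge
    ([lister_edge]): at most one end is coloured, and the other is left with one
    token.  If a vertex with one token is joined to a cycle of length at least 4 off
    which it lies, Lister wins with a budget of the number of vertices minus 2
    ([lister_lollipop]).  Hence
    an edge with both ends off a cycle, each joined to that cycle without using the
    other, gives a win with budget [n - 2] ([lister_edge_off_cycle]).  In a minimal
    graph [U] on which Lister wins at all, every degree is at least 2 and everything
    is connected.  Take a shortest cycle in it.  If it is all of [U], Painter wins
    ([painter_even_cycle]).  Otherwise the absence of such an edge forces the vertices
    outside to be independent, the cycle to have length 4, and [U] to be a
    [K_{2,m}].  Painter wins on [K_{2,3}] ([painter_K23]), so [m] is at least 4, and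
    [K_{2,4}] costs exactly 5 ([lister_K24], [painter_K24]), which is [n - 1] only
    when [n = 6]. *)

(** * The game with a budget *)

Section BudgetGame.

Variables (T : finType) (e : rel T).
Hypothesis e_irr : irreflexive e.
Implicit Types (U V X : {set T}) (f g : T -> nat) (S : seq {set T} -> {set T}).

Definition spend V f : T -> nat := fun v => f v - (v \in V).

(** The vertices of [U] are still uncoloured, [f] counts the tokens, and [b] bounds
    the sum of [#|V| - 1] over the rounds to come.  Lister never marks a single
    vertex, because Painter would colour it at no loss, nor a coloured one: its
    tokens can be spent alone, for free, at the end. *)
Inductive lister_wins : nat -> {set T} -> (T -> nat) -> Prop :=
| Starved b U f v of v \in U & f v = 0 : lister_wins b U f
| Marking b U f V of V \subset U & 2 <= #|V| <= b.+1 &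
    (forall X, X \subset V -> independent e X ->
       lister_wins (b - #|V|.-1) (U :\: X) (spend V f)) :
    lister_wins b U f.

(** Lister repeats the same marks: the additional vertices are ignored, and with
    fewer tokens a vertex can only starve earlier. *)
Lemma lister_wins_mono b b' U U' f f' :
  b <= b' -> U \subset U' -> {in U, forall v, f' v <= f v} ->
  lister_wins b U f -> lister_wins b' U' f'.
Proof.
move=> le_b sU le_f w; elim: w b' U' f' le_b sU le_f => {b U f}.
  move=> b U f v vU fv0 b' U' f' _ sU le_f.
  apply: (@Starved _ _ _ v); first exact: subsetP sU v vU.
  by apply/eqP; rewrite -leqn0 -fv0 le_f.
move=> b U f V sVU cV _ IH b' U' f' le_b sU le_f.
apply: (@Marking _ _ _ V); first exact: subset_trans sVU sU.
  by case/andP: cV => -> /leq_trans->.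
move=> X sXV iX; apply: (IH X) => //; first exact: leq_sub2r.
  exact: setSD.
by move=> v /setDP[vU _]; rewrite leq_sub2r ?le_f.
Qed.

Lemma painter_invariant (I : nat -> {set T} -> (T -> nat) -> Prop) :
  (forall b U f, I b U f -> {in U, forall v, 0 < f v}) ->
  (forall b U f V, I b U f -> V \subset U -> 2 <= #|V| <= b.+1 -> exists X,
     [/\ X \subset V, independent e X &
         I (b - #|V|.-1) (U :\: X) (spend V f)]) ->
  forall b U f, I b U f -> ~ lister_wins b U f.
Proof.
move=> Ipos Istep b U f IbUf w; elim: w IbUf => {b U f}.
  by move=> b U f v vU fv0 /Ipos/(_ v vU); rewrite fv0.
move=> b U f V sVU cV _ IH /Istep/(_ sVU cV)[X [sX iX]]; exact: IH.
Qed.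

Lemma painter_step b U f :
  {in U, forall v, 0 < f v} ->
  (forall V, V \subset U -> 2 <= #|V| <= b.+1 -> exists X,
     [/\ X \subset V, independent e X &
         ~ lister_wins (b - #|V|.-1) (U :\: X) (spend V f)]) ->
  ~ lister_wins b U f.
Proof.
move=> fpos step w.
case: {-1}b {-1}U {-1}f / w (erefl b) (erefl U) (erefl f) => b' U' f'.
  by move=> v vU fv0 _ eU ef; have := fpos v; rewrite eU ef fv0 => /(_ vU).
move=> V sVU cV wX eb eU ef; case: (step V); rewrite ?eU ?eb // => X [sX iX []].
by rewrite ef; apply: wX.
Qed.

(** A marked set with at most one element is independent, so Painter colours it
    whole; this is why [Marking] may ask for two vertices. *)
Lemma painter_answer b U f V :
  ~ lister_wins b U f -> V \subset U -> #|V| <= b.+1 -> exists X,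
    [/\ X \subset V, independent e X &
        ~ lister_wins (b - #|V|.-1) (U :\: X) (spend V f)].
Proof.
move=> nw sVU cV; case: (ltnP 1 #|V|) => [V2|V1].
  apply: contrapT => noX; apply: nw; apply: (@Marking _ _ _ V); rewrite ?V2 //.
  move=> X sX iX; apply: contrapT => nwX; apply: noX; by exists X.
exists V; split=> //.
  by move=> y z yV zV; move/card_le1_eqP: V1 => /(_ _ _ yV zV)->; rewrite e_irr.
move=> w; apply: nw; apply: lister_wins_mono w; rewrite ?leq_subr ?subsetDl //.
by move=> v /setDP[vU vV]; rewrite /spend (negPf vV) subn0.
Qed.

Lemma painter_fed b U f :
  ~ lister_wins b U f -> {in U, forall v, 0 < f v}.
Proof.
move=> nw v vU; rewrite lt0n; apply/eqP => fv0; apply: nw.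
exact: (@Starved _ _ _ v).
Qed.

(** The default [set0] stands for having no reply that keeps the win. *)
Definition reply b U f V : {set T} :=
  odflt set0 [pick X : {set T} |
    `[< [/\ X \subset V, independent e X &
        ~ lister_wins (b - #|V|.-1) (U :\: X) (spend V f)] >]].

Lemma reply_valid b U f V : reply b U f V \subset V /\ independent e (reply b U f V).
Proof.
rewrite /reply; case: pickP => [X /asboolP[]|_] //=; split; first exact: sub0set.
by move=> x y; rewrite inE.
Qed.

Lemma reply_wins b U f V :
  ~ lister_wins b U f -> V \subset U -> #|V| <= b.+1 ->
  ~ lister_wins (b - #|V|.-1) (U :\: reply b U f V) (spend V f).
Proof.
move=> nw sVU cV; rewrite /reply; case: pickP => [X /asboolP[]|noX] //=.
by have [X HX] := painter_answer nw sVU cV; have /asboolP[] := noX X.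
Qed.

(** Marks on coloured vertices are dropped.  This never increases the excess of a
    round, so the recorded budget is at least the true one. *)
Definition after (st : nat * {set T} * (T -> nat)) V :=
  let: (b, U, f) := st in
  (b - #|V :&: U|.-1, U :\: reply b U f (V :&: U), spend (V :&: U) f).

Definition reply_to st (h : seq {set T}) : {set T} :=
  let: (b, U, f) := foldl after st (take (size h).-1 h) in
  reply b U f (last set0 h :&: U).

Lemma reply_to_rcons st h V :
  reply_to st (rcons h V) =
  let: (b, U, f) := foldl after st h in reply b U f (V :&: U).
Proof. by rewrite /reply_to size_rcons last_rcons -cats1 take_size_cat. Qed.

(** Answering with [reply] keeps the position won for Painter.  A vertex that is
    uncoloured at the end has spent all its tokens, and such a position is lost. *)
Lemma painter_strategy b f :
  ~ lister_wins b [set: T] f -> exists2 S, valid_strategy e S &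
    forall Vs, legal f Vs -> \sum_(V <- Vs) #|V|.-1 <= b -> all_colored S Vs.
Proof.
move=> nw; pose st := (b, [set: T], f); exists (reply_to st).
  move=> h V; rewrite reply_to_rcons; case: foldl => [[b' U'] f'].
  have [sX iX] := reply_valid b' U' f' (V :&: U'); split=> //.
  by apply: subset_trans sX (subsetIl _ _).
move=> Vs [_ cVs] leVs.
have inv (h : seq {set T}) : \sum_(V <- h) #|V|.-1 <= b -> let: (b', U', f') := foldl after st h in
  [/\ ~ lister_wins b' U' f', b <= b' + \sum_(V <- h) #|V|.-1,
      {in U', forall v, f' v = f v - count (fun V : {set T} => v \in V) h} &
      forall v, v \notin U' -> exists2 i, i < size h & v \in reply_to st (take i.+1 h)].
  elim/last_ind: h => [|h V IH] le_h /=.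
    rewrite big_nil addn0; split=> // v; rewrite ?subn0 ?inE //.
  have rpl := reply_to_rcons st h V.
  move: le_h; rewrite -cats1 big_cat big_seq1 cats1 /= => le_h.
  have {IH} := IH (leq_trans (leq_addr _ _) le_h).
  rewrite -cats1 foldl_cat /= cats1; case: foldl rpl => [[b' U'] f'] rpl [nw' le_b f'E col].
  have cW : #|V :&: U'| <= #|V| by apply: subset_leq_card; apply: subsetIl.
  split.
  - apply: reply_wins => //; [exact: subsetIr | lia].
  - lia.
  - move=> v /setDP[vU vX]; rewrite /spend f'E // -cats1 count_cat /= addn0.
    by rewrite inE vU andbT subnDA.
  move=> v; rewrite inE negb_and negbK => vUX.
  have [vU|/col[i lt_i v_i]] := boolP (v \in U').
    exists (size h); first by rewrite size_rcons.
    rewrite -(size_rcons h V) take_size rpl.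
    by move: vUX; rewrite vU orbF.
  exists i; first by rewrite size_rcons ltnW.
  by rewrite -cats1 takel_cat.
move=> v; have := inv Vs leVs; case: foldl => [[b' U'] f'] [nw' _ f'E col].
apply: col; apply/negP => vU.
by have := painter_fed nw' vU; rewrite f'E // cVs subnn.
Qed.

Lemma sum_marks (Vs : seq {set T}) :
  \sum_(V <- Vs) #|V| = \sum_v count (fun V : {set T} => v \in V) Vs.
Proof.
rewrite (eq_bigr (fun V => \sum_v (v \in V))); last first.
  by move=> V _; rewrite -sum1_card big_mkcond; apply: eq_bigr => v _; case: (v \in V).
rewrite exchange_big; apply: eq_bigr => v _; rewrite -sum1_count [RHS]big_mkcond.
by apply: eq_bigr => V _; case: (v \in V).
Qed.

Lemma sum_marks_nonempty (Vs : seq {set T}) :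
  (forall V, V \in Vs -> V != set0) ->
  \sum_(V <- Vs) #|V|.-1 + size Vs = \sum_(V <- Vs) #|V|.
Proof.
move=> Vs0; rewrite -sum1_size -big_split /= big_seq [RHS]big_seq.
by apply: eq_bigr => V /Vs0; rewrite -card_gt0 => ?; lia.
Qed.

Lemma painter_in b t f :
  \sum_v f v <= b + t -> ~ lister_wins b [set: T] f -> paintable_in e f t.
Proof.
move=> le_b /painter_strategy[S vS Swin]; exists S => // Vs szVs legVs.
apply: Swin => //; have [Vs0 cVs] := legVs.
have := sum_marks_nonempty Vs0; rewrite sum_marks szVs.
by rewrite (eq_bigr f) // => ?; lia.
Qed.

Lemma painter_unbounded b f :
  \sum_v f v <= b -> ~ lister_wins b [set: T] f -> paintable e f.
Proof.
move=> le_b /painter_strategy[S vS Swin]; exists S => // Vs legVs.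
apply: Swin => //; have [Vs0 cVs] := legVs.
have := sum_marks_nonempty Vs0; rewrite sum_marks.
by rewrite (eq_bigr f) // => ?; lia.
Qed.

Lemma sum_spend V f : {in V, forall v, 0 < f v} ->
  \sum_v spend V f v + #|V| = \sum_v f v.
Proof.
move=> fpos; rewrite -sum1_card [X in _ + X]big_mkcond -big_split /=.
apply: eq_bigr => v _; rewrite /spend; case: ifP => vV; last by rewrite subn0 addn0.
exact/subnK/fpos.
Qed.

(** The next round takes all the vertices that have as many tokens as there are
    rounds left.  If there are none, it takes a single vertex, so that enough tokens
    remain to keep the later rounds nonempty. *)
Lemma schedule_exists t g :
  (forall v, g v <= t) -> t <= \sum_v g v -> exists Vs : seq {set T},
    [/\ size Vs = t, forall V, V \in Vs -> V != set0 &
        forall v, count (fun V : {set T} => v \in V) Vs = g v].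
Proof.
elim: t g => [|t IH] g le_g le_t.
  exists [::]; split=> // v; by apply/esym/eqP; rewrite -leqn0 le_g.
suff [V [V0 gpos le_g' le_t']] : exists V, [/\ V != set0, {in V, forall v, 0 < g v},
    forall v, spend V g v <= t & t <= \sum_v spend V g v].
  have [Vs [szVs Vs0 cVs]] := IH _ le_g' le_t'; exists (V :: Vs).
  split=> [|W|v] /=; first by rewrite szVs.
    by rewrite inE => /predU1P[->|/Vs0].
  rewrite cVs /spend; case: (boolP (v \in V)) => vV; last by rewrite subn0.
  exact/subnKC/gpos.
pose Z := [set v | g v == t.+1].
have [Z0|[z zZ]] := set_0Vmem Z.
  have [v gv|g0] := pickP (fun v => 0 < g v); last first.
    by move: le_t; rewrite big1 // => v _; apply/eqP; rewrite -leqn0 leqNgt g0.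
  have gpos : {in [set v], forall v, 0 < g v} by move=> u /set1P->.
  exists [set v]; split=> //.
  - by apply/set0Pn; exists v; rewrite inE.
  - move=> u; apply: leq_trans (leq_subr _ _) _.
    have : u \notin Z by rewrite Z0 inE.
    by rewrite inE; have := le_g u; lia.
  - by have := sum_spend gpos; rewrite cards1; lia.
have gpos : {in Z, forall v, 0 < g v} by move=> u; rewrite inE => /eqP->.
exists Z; split=> //; first by apply/set0Pn; exists z.
  move=> u; rewrite /spend inE; have := le_g u; case: eqP; lia.
rewrite (bigD1 z) //= {1}/spend zZ; move: zZ; rewrite inE => /eqP->.
by rewrite subn1 leq_addr.
Qed.

(** The number [t] of rounds left drops by one in each round and the budget by at
    least one, so [b + 2 <= t] persists and [t] is at least 2 when some vertex
    starves.  No vertex has more than two tokens, so the tokens that remain can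
    then be spent in exactly [t] nonempty rounds by [schedule_exists]. *)
Lemma lister_extends b U f : lister_wins b U f ->
  forall S h g t, valid_strategy e S ->
  {in U, forall v i, i < size h -> v \notin S (take i.+1 h)} ->
  {in U, g =1 f} -> (forall v, g v <= 2) ->
  b + t = \sum_v g v -> b + 2 <= t ->
  exists Vs v,
    [/\ size Vs = t, forall V, V \in Vs -> V != set0,
        forall v, count (fun V : {set T} => v \in V) Vs = g v &
        forall i, i < size (h ++ Vs) -> v \notin S (take i.+1 (h ++ Vs))].
Proof.
have starved b0 U0 f0 v : v \in U0 -> f0 v = 0 -> forall S h g t, valid_strategy e S ->
  {in U0, forall v i, i < size h -> v \notin S (take i.+1 h)} ->
  {in U0, g =1 f0} -> (forall v, g v <= 2) ->
  b0 + t = \sum_v g v -> b0 + 2 <= t ->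
  exists Vs v,
    [/\ size Vs = t, forall V, V \in Vs -> V != set0,
        forall v, count (fun V : {set T} => v \in V) Vs = g v &
        forall i, i < size (h ++ Vs) -> v \notin S (take i.+1 (h ++ Vs))].
  move=> vU fv0 S h g t vS unc gf g2 bt b2.
  have [Vs [szVs Vs0 cVs]] : exists Vs : seq {set T},
    [/\ size Vs = t, forall V, V \in Vs -> V != set0 &
        forall v, count (fun V : {set T} => v \in V) Vs = g v].
    apply: schedule_exists => [u|]; [have := g2 u; lia | lia].
  exists Vs, v; split=> // i; rewrite size_cat => lt_i.
  have [lt_ih|le_hi] := ltnP i (size h).
    by rewrite takel_cat // unc.
  have lt_iV : i - size h < size Vs by lia.
  rewrite take_cat ltnNge leqW //= subSn // (take_nth set0) // -rcons_cat.
  have [/subsetP sX _] := vS (h ++ take (i - size h) Vs) (nth set0 Vs (i - size h)).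
  apply/negP => /sX vV.
  have : has (fun V : {set T} => v \in V) Vs.
    by apply/hasP; exists (nth set0 Vs (i - size h)) => //; rewrite mem_nth.
  by rewrite has_count cVs gf // fv0.
move=> w; elim: w => {b U f} [|b U f V sVU cV _ IH]; first exact: starved.
move=> S h g t vS unc gf g2 bt b2.
have [fpos|] := pselect {in V, forall v, 0 < f v}; last first.
  move=> nfpos; suff [v vU fv0] : exists2 v, v \in U & f v = 0.
    exact: (@starved b U f v).
  apply: contrapT => no; apply: nfpos => v /(subsetP sVU) vU.
  by rewrite lt0n; apply/eqP => fv0; apply: no; exists v.
have gpos : {in V, forall v, 0 < g v}.
  by move=> v vV; rewrite gf ?fpos //; apply: subsetP sVU _ vV.
have [sX iX] := vS h V; have sumV := sum_spend gpos.
case: (IH _ sX iX S (rcons h V) (spend V g) t.-1) => //.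
- move=> v /setDP[vU vX] i; rewrite size_rcons ltnS leq_eqVlt => /predU1P[->|lt_i].
    by rewrite -(size_rcons h V) take_size.
  by rewrite -cats1 takel_cat // unc.
- by move=> v /setDP[vU _]; rewrite /spend gf.
- by move=> v; apply: leq_trans (leq_subr _ _) (g2 v).
- lia.
- lia.
move=> Vs [v [szVs Vs0 cVs ncol]]; exists (V :: Vs), v; split=> /=.
- rewrite szVs; lia.
- move=> W; rewrite inE => /predU1P[->|/Vs0//]; rewrite -card_gt0; lia.
- move=> u; rewrite cVs /spend; case: (boolP (u \in V)) => uV; last by rewrite subn0.
  exact/subnKC/gpos.
by rewrite -cat_rcons.
Qed.

Lemma lister_in b t f :
  (forall v, f v <= 2) -> b + t = \sum_v f v -> b + 2 <= t ->
  lister_wins b [set: T] f -> ~ paintable_in e f t.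
Proof.
move=> f2 bt b2 w [S vS Swin].
have [//|//|//|//|//|Vs [v [szVs Vs0 cVs ncol]]] := @lister_extends _ _ _ w S [::] f t vS.
have [i lt_i] := Swin Vs szVs (conj Vs0 cVs) v.
by apply/negP/ncol.
Qed.

End BudgetGame.

(** * Strategies for Lister *)

Section ListerStrategies.

Variables (T : finType) (e : rel T).
Hypotheses (e_sym : symmetric e) (e_irr : irreflexive e).
Implicit Types (U V X : {set T}) (f g : T -> nat) (D : seq T).

Lemma edge_neq u v : e u v -> u != v.
Proof. by apply: contraTneq => ->; rewrite e_irr. Qed.

(** Lister marks [u] and [v]: Painter colours at most one of them, and the other
    loses a token. *)
Lemma lister_edge b U f u v : u \in U -> v \in U -> e u v ->
  (forall g, (forall x, g x <= f x) -> g v <= (f v).-1 ->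
     lister_wins e b (U :\ u) g) ->
  (forall g, (forall x, g x <= f x) -> g u <= (f u).-1 ->
     lister_wins e b (U :\ v) g) ->
  lister_wins e b.+1 U f.
Proof.
move=> uU vU euv wu wv; have cV : #|[set u; v]| = 2 by rewrite cards2 edge_neq.
apply: (@Marking _ _ _ _ _ [set u; v]); rewrite ?cV //.
  by apply/subsetP => x /set2P[] ->.
move=> X sX iX; rewrite subn1 /=.
have [vX|vX] := boolP (v \in X).
  have uX : u \notin X by apply/negP => uX; have := iX _ _ uX vX; rewrite euv.
  apply: lister_wins_mono (wv (spend [set u; v] f) _ _) => //.
  - apply/subsetP => x; rewrite !inE => /andP[xv ->]; rewrite andbT.
    by apply/negP => xX; have /set2P[E|E] := subsetP sX _ xX; move: xv uX; rewrite -E ?xX ?eqxx.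
  - by move=> x; exact: leq_subr.
  - by rewrite /spend !inE eqxx subn1.
apply: lister_wins_mono (wu (spend [set u; v] f) _ _) => //.
- apply/subsetP => x; rewrite !inE => /andP[xu ->]; rewrite andbT.
  by apply/negP => xX; have /set2P[E|E] := subsetP sX _ xX; move: xu vX; rewrite -E ?xX ?eqxx.
- by move=> x; exact: leq_subr.
- by rewrite /spend !inE eqxx orbT subn1.
Qed.

(** Marking the first edge forces Painter to colour [x], which has no other token.
    The next vertex is then the end with one token of a shorter path. *)
Lemma lister_path x p U f : {subset x :: p <= U} -> path e x p -> uniq (x :: p) ->
  p != [::] -> (forall v, f v <= 2) -> f x <= 1 -> f (last x p) <= 1 ->
  lister_wins e (size p) U f.
Proof.
elim: p x U f => // y p IH x U f sU /=/andP[exy pp] /andP[xp up] _ f2 fx fl.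
have xU : x \in U by rewrite sU ?mem_head.
have yU : y \in U by rewrite sU // inE mem_head orbT.
apply: (@lister_edge _ _ _ x y) => // g le_g gz; last first.
  by apply: (@Starved _ _ _ _ _ x); [rewrite !inE edge_neq | lia].
have [p0|p0] := eqVneq p [::].
  move: fl; rewrite p0 /= => fy.
  by apply: (@Starved _ _ _ _ _ y); [rewrite !inE eq_sym edge_neq | lia].
apply: (IH y) => //.
- move=> z zp; rewrite !inE sU 1?inE ?zp ?orbT // andbT.
  by apply: contraNneq xp => <-.
- by move=> v; exact: leq_trans (le_g v) (f2 v).
- have := f2 y; lia.
- exact: leq_trans (le_g _) fl.
Qed.

(** Opening with the second edge saves one unit: either the path is shortened by
    two, or the first two vertices are adjacent with one token each. *)
Lemma lister_long_path x p U f : {subset x :: p <= U} -> path e x p ->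
  uniq (x :: p) -> 3 <= size p -> (forall v, f v <= 2) -> f x <= 1 ->
  f (last x p) <= 1 -> lister_wins e (size p).-1 U f.
Proof.
case: p => [|c [|d p]] //= sU /and3P[exc ecd pp] /and3P[xp cp up] sz f2 fx fl.
have cU : c \in U by rewrite sU // !inE eqxx ?orbT.
have dU : d \in U by rewrite sU // !inE eqxx ?orbT.
apply: (@lister_edge _ _ _ c d) => // g le_g gz.
  apply: (@lister_path d) => //.
  - move=> z zp; rewrite !inE sU ?inE; last by move: zp; rewrite inE => ->; rewrite !orbT.
    by rewrite andbT; apply: contraNneq cp => <-.
  - by case: (p) sz.
  - by move=> v; exact: leq_trans (le_g v) (f2 v).
  - by move: (f2 d) gz; clear; lia.
  - exact: leq_trans (le_g _) fl.
apply: lister_wins_mono (@lister_path x [:: c] _ g _ _ _ _ _ _ _) => //=.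
- move=> z; rewrite !inE => /pred2P[]->; rewrite sU ?inE ?eqxx ?orbT // andbT.
    by apply: contraNneq xp => ->; rewrite !inE eqxx orbT.
  exact: edge_neq.
- by rewrite exc.
- by rewrite inE andbT edge_neq.
- by move=> v; exact: leq_trans (le_g v) (f2 v).
- exact: leq_trans (le_g _) fx.
- by move: (f2 c) gz; clear; lia.
Qed.

Lemma path_first_hit D x p : path e x p -> last x p \in D -> exists p',
  [/\ path e x p', uniq (x :: p'), {subset x :: p' <= x :: p}, last x p' \in D &
      {in belast x p', forall z, z \notin D}].
Proof.
move=> pp; case/shortenP: pp => {}p' pp up sp lD.
suff [p1 [pp1 up1 sp1 lD1 bD1]] : exists p1, [/\ path e x p1, uniq (x :: p1),
    {subset x :: p1 <= x :: p'}, last x p1 \in D & {in belast x p1, forall z, z \notin D}].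
  exists p1; split=> // z /sp1; rewrite !inE => /predU1P[->|/sp zp]; rewrite ?eqxx //.
  by rewrite zp orbT.
elim: p' {sp} x pp up lD => [|y p' IH] x.
  by move=> _ _ lD; exists [::]; split.
move=> /=/andP[exy pp] /andP[xp up] lD; have [xD|xD] := boolP (x \in D).
  by exists [::]; split=> // z; rewrite inE => /eqP->; rewrite mem_head.
have [p1 [pp1 up1 sp1 lD1 bD1]] := IH _ pp up lD.
exists (y :: p1); split=> //.
- by rewrite /= exy.
- apply/andP; split=> //; apply: contra xp; exact: sp1.
- move=> z; rewrite inE => /predU1P[->|/sp1 zp]; first exact: mem_head.
  by rewrite inE zp orbT.
- by move=> z /=; rewrite inE => /predU1P[->|/bD1].
Qed.

Lemma rev_cycle_path x s : path e x (rcons s x) -> path e x (rcons (rev s) x).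
Proof.
move=> ps; have := rev_path e x (rcons s x).
rewrite last_rcons belast_rcons rev_cons => ->.
by rewrite -(eq_path (e := e)) // => y z; rewrite e_sym.
Qed.

(** Let [p] be the point where the path from [u] enters [D], followed on [D] by [p']
    and [q'].  Lister marks the edge [p' q'].  If [q'] is coloured, [p'] has one token
    and is next to [p]; if [p'] is coloured, [q'] has one token and is joined to [p]
    the long way round.  In both cases [u] is one end of a path with one token at
    each end.  The long path has at least three edges, so [lister_long_path] applies
    and yields the bound [#|U| - 2], better by one than [lister_path] would. *)
Lemma lister_lollipop U f u q D : {subset u :: q <= U} -> {subset D <= U} ->
  path e u q -> last u q \in D -> u \notin D -> cycle e D -> uniq D ->
  4 <= size D -> (forall v, f v <= 2) -> f u <= 1 ->
  lister_wins e (#|U| - 2) U f.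
Proof.
move=> sqU sDU pq lD uD cD uqD szD f2 fu.
have {q pq lD sqU} [q [pq uq sqU lD bD]] : exists q, [/\ path e u q, uniq (u :: q),
    {subset u :: q <= U}, last u q \in D & {in belast u q, forall z, z \notin D}].
  have [q' [pq' uq' sq' lD' bD']] := path_first_hit pq lD.
  by exists q'; split=> // z /sq'/sqU.
have q0 : 0 < size q by case: (q) lD => //=; rewrite (negPf uD).
move: lD; case/rot_to=> i D' ED.
have {}cD : cycle e (last u q :: D') by rewrite -ED rot_cycle.
have {uqD}uD' : uniq (last u q :: D') by rewrite -ED rot_uniq.
have sD : D =i last u q :: D' by move=> z; rewrite -ED mem_rot.
have {i ED}szD' : 3 <= size D'.
  by have := size_rot i D; rewrite ED /=; lia.
have disj z : z \in u :: q -> z \notin D'.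
  rewrite lastI mem_rcons inE => /predU1P[->|/bD]; first by case/andP: uD'.
  by rewrite sD inE negb_or => /andP[].
have szU : size q + size D' < #|U|.
  have uqD : uniq ((u :: q) ++ D').
    have := uD'; rewrite cons_uniq => /andP[_ uD'']; rewrite cat_uniq uq uD'' andbT.
    by apply/hasPn => z zD; apply/negP => /disj; rewrite zD.
  rewrite -[_.+1]/((size q).+1 + size D') -[(size q).+1]/(size (u :: q)) -size_cat.
  rewrite -(card_uniqP uqD) subset_leq_card //.
  apply/subsetP => z; rewrite mem_cat => /orP[/sqU//|zD].
  by apply: sDU; rewrite sD inE zD orbT.
case: D' cD uD' sD szD' disj szU => [|p' [|q' r]] // cD uD' sD szD' disj szU.
have rcD : path e (last u q) (rev (q' :: r)).
  have := rev_cycle_path cD; rewrite (rev_cons p') !(rcons_path e (last u q)).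
  by case/andP => /andP[].
have [ep ep'] : e (last u q) p' /\ e p' q' by move: cD => /= /and3P[].
have [p'U q'U] : p' \in U /\ q' \in U by split; apply: sDU; rewrite sD !inE eqxx ?orbT.
have := uD'; rewrite !cons_uniq => /and4P[_ p'r q'r ur].
have szq : size (q' :: r) >= 2 by [].
have EU : #|U| - 2 = (#|U| - 3).+1 by move: szU; clear; rewrite /=; lia.
rewrite EU.
apply: (@lister_edge _ _ _ p' q') => // g le_g gz; last first.
  apply: lister_wins_mono (@lister_path u (rcons q p') _ g _ _ _ _ _ _ _) => //.
  - by move: szU szD'; clear; rewrite size_rcons /=; lia.
  - move=> z; rewrite -rcons_cons mem_rcons inE => /predU1P[->|zq].
      by rewrite !inE edge_neq.
    rewrite !inE sqU // andbT; apply: contraTneq zq => ->.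
    by apply/negP => /disj; rewrite !inE eqxx orbT.
  - by rewrite rcons_path pq.
  - rewrite -rcons_cons rcons_uniq uq andbT.
    by apply/negP => /disj; rewrite !inE eqxx.
  - by case: (q).
  - by move=> v; exact: leq_trans (le_g v) (f2 v).
  - exact: leq_trans (le_g _) fu.
  - by rewrite last_rcons; move: (f2 p') gz; clear; lia.
apply: lister_wins_mono (@lister_long_path u (q ++ rev (q' :: r)) _ g _ _ _ _ _ _ _) => //.
- by move: szU; clear; rewrite size_cat size_rev /=; lia.
- move=> z; rewrite -cat_cons mem_cat mem_rev => /orP[zq|zr].
    rewrite !inE sqU // andbT; apply: contraTneq zq => ->.
    by apply/negP => /disj; rewrite !inE eqxx.
  rewrite !inE sDU; last by rewrite sD !inE -in_cons zr !orbT.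
  by rewrite andbT; apply: contraNneq p'r => <-.
- by rewrite cat_path pq.
- rewrite -cat_cons cat_uniq uq rev_uniq cons_uniq q'r ur !andbT /=.
  apply/hasPn => z; rewrite mem_rev => zr; apply/negP => /disj.
  by rewrite inE zr orbT.
- by move: q0 szD'; clear; rewrite size_cat size_rev /=; lia.
- by move=> v; exact: leq_trans (le_g v) (f2 v).
- exact: leq_trans (le_g _) fu.
- by rewrite last_cat rev_cons last_rcons; move: (f2 q') gz; clear; lia.
Qed.

(** After [a] and [b] are marked, the one that is not coloured is the start of a
    lollipop that avoids the other. *)
Lemma lister_edge_off_cycle U a b D qa qb : a \in U -> b \in U -> e a b ->
  {subset D <= U} -> cycle e D -> uniq D -> 4 <= size D -> a \notin D -> b \notin D ->
  path e a qa -> {subset qa <= U :\ b} -> last a qa \in D ->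
  path e b qb -> {subset qb <= U :\ a} -> last b qb \in D ->
  lister_wins e (#|U| - 2) U (fun=> 2).
Proof.
move=> aU bU eab sD cD uD szD aD bD pa sa la pb sb lb.
have szU : size D < #|U|.
  rewrite -(card_uniqP uD) (cardsD1 a) aU add1n ltnS subset_leq_card //.
  apply/subsetP => z zD; rewrite !inE sD // andbT.
  by apply: contraNneq aD => <-.
rewrite (_ : #|U| - 2 = (#|U|.-1 - 2).+1); last by move: szU szD; clear; lia.
have cU c : c \in U -> #|U :\ c| = #|U|.-1 by move=> cU; rewrite (cardsD1 c U) cU.
have sDc c : c \notin D -> {subset D <= U :\ c}.
  by move=> cD' z zD; rewrite !inE sD // andbT; apply: contraNneq cD' => <-.
have ab := edge_neq eab.
apply: (@lister_edge _ _ _ a b) => // g le_g gz.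
  rewrite -(cU a) //; apply: lister_lollipop (sDc _ aD) pb _ _ _ _ _ _ _ => //.
  by move=> z; rewrite inE => /predU1P[->|/sb//]; rewrite !inE eq_sym ab.
rewrite -(cU b) //; apply: lister_lollipop (sDc _ bD) pa _ _ _ _ _ _ _ => //.
by move=> z; rewrite inE => /predU1P[->|/sa//]; rewrite !inE ab.
Qed.

(** The detour through [w] and the arc [q :: B] close up to a cycle that avoids the
    first two vertices of [A], and these are joined to it from both sides. *)
Lemma lister_theta U w p A q B : {subset p :: A ++ q :: B <= U} -> w \in U ->
  cycle e (p :: A ++ q :: B) -> uniq (p :: A ++ q :: B) ->
  w \notin p :: A ++ q :: B -> e w p -> e w q -> 1 < size A -> 0 < size B ->
  lister_wins e (#|U| - 2) U (fun=> 2).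
Proof.
case: A => [|a1 [|a2 A]] //; rewrite !cat_cons => sD wU cD uD wD ewp ewq _ szB.
move: (cD) => /=; rewrite rcons_cat cat_path /= => /and5P[epa1 ea12 pA elq pB].
move: (uD); rewrite !cons_uniq cat_uniq cons_uniq.
move=> /and5P[pn a1n a2n uA /and3P[hn qB uB]].
apply: (@lister_edge_off_cycle U a1 a2 (w :: q :: rcons B p) [:: p] (rcons A q)) => //.
- by apply: sD; rewrite !inE eqxx ?orbT.
- by apply: sD; rewrite !inE eqxx ?orbT.
- move=> z; rewrite !inE mem_rcons inE => /or4P[/eqP->//|/eqP->|/eqP->|zB]; apply: sD;
    by rewrite !(in_cons, mem_cat) ?eqxx ?zB ?orbT.
- by rewrite /= ewq rcons_path last_rcons pB e_sym ewp.
- rewrite !cons_uniq rcons_uniq !(in_cons, mem_rcons) !negb_or uB qB.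
  move: wD pn; rewrite !(in_cons, mem_cat) !negb_or.
  move=> /and5P[wp _ _ _ /andP[wq wB]] /and5P[_ _ _ pq pB'].
  by rewrite wq wp wB pB' eq_sym pq.
- by rewrite /= size_rcons !ltnS.
- move: wD pn a1n; rewrite !(in_cons, mem_cat, mem_rcons) !negb_or.
  move=> /and5P[wp wa1 _ _ _] /andP[pa1 _] /and4P[_ _ a1q a1B].
  by rewrite eq_sym wa1 a1q eq_sym pa1 a1B.
- move: wD pn a2n; rewrite !(in_cons, mem_cat, mem_rcons) !negb_or.
  move=> /and5P[_ _ wa2 _ _] /and3P[_ pa2 _] /and3P[_ a2q a2B].
  by rewrite eq_sym wa2 a2q eq_sym pa2 a2B.
- by rewrite /= e_sym epa1.
- move=> z; rewrite inE => /eqP->; rewrite !inE sD ?mem_head // andbT.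
  by move: pn; rewrite !in_cons !negb_or => /and3P[].
- by rewrite !inE mem_rcons inE eqxx !orbT.
- by rewrite rcons_path pA.
- move=> z; rewrite mem_rcons inE => zqA; rewrite !inE sD; last first.
    by rewrite !(in_cons, mem_cat); case/orP: zqA => ->; rewrite ?orbT.
  rewrite andbT; apply: contraNneq a1n => <-.
  by rewrite !(in_cons, mem_cat); case/orP: zqA => ->; rewrite ?orbT.
- by rewrite last_rcons !inE eqxx orbT.
Qed.

Lemma path_fails (r : rel T) x p : path e x p -> ~~ path r x p ->
  exists u v, [/\ u \in x :: p, v \in x :: p, e u v & ~~ r u v].
Proof.
elim: p x => //= y p IH x /andP[exy pp]; rewrite negb_and.
case/orP=> [nr|/(IH _ pp)[u [v [uI vI euv nr]]]].
  by exists x, y; rewrite !inE !eqxx orbT.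
by exists u, v; rewrite inE uI inE vI !orbT.
Qed.

Lemma alternating_path (X : {set T}) x p :
  path (fun u v => (u \in X) != (v \in X)) x p ->
  (last x p \in X) = (x \in X) (+) odd (size p).
Proof.
elim: p x => [|y p IH] x /=; first by rewrite addbF.
by move=> /andP[neq /IH->]; move: neq; case: (x \in X); case: (y \in X); case: odd.
Qed.

(** Lister marks the whole cycle.  Colouring alternates along the cycle unless two
    consecutive vertices are left uncoloured, and parity forbids alternation; the two
    vertices have one token each. *)
Lemma lister_odd_cycle U D : {subset D <= U} -> cycle e D -> uniq D -> odd (size D) ->
  lister_wins e (size D) U (fun=> 2).
Proof.
case: D => // x s sD cD uD oD.
have s0 : 0 < size s by case: (s) cD => //=; rewrite e_irr.
set D := x :: s in sD uD oD *.
have cV : #|[set z in D]| = size D by rewrite cardsE (card_uniqP uD).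
apply: (@Marking _ _ _ _ _ [set z in D]).
- by apply/subsetP => z; rewrite inE => /sD.
- by rewrite cV leqnSn andbT.
move=> X sX iX; rewrite cV (_ : _ - _ = 1); last by rewrite /D /= subSnn.
have npa : ~~ path (fun u v => (u \in X) != (v \in X)) x (rcons s x).
  apply/negP => /alternating_path; rewrite last_rcons size_rcons.
  by rewrite [odd _]oD; case: (x \in X).
have [u [v [uD' vD' euv]]] := path_fails cD npa; rewrite negbK => /eqP uv.
have rD z : z \in x :: rcons s x -> z \in D.
  by rewrite inE mem_rcons => /predU1P[->|]; rewrite ?mem_head.
have uX : u \notin X.
  by apply/negP => uX; have := iX _ _ uX (etrans (esym uv) uX); rewrite euv.
have vX : v \notin X by rewrite -uv.
have f1 z : z \in D -> spend [set z in D] (fun=> 2) z <= 1.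
  by rewrite /spend inE => ->.
apply: (@lister_path u [:: v]) => //=.
- move=> z; rewrite !inE => /pred2P[]->; rewrite ?uX ?vX sD //; exact: rD.
- by rewrite euv.
- by rewrite inE edge_neq.
- by move=> z; exact: leq_subr.
- exact/f1/rD.
- exact/f1/rD.
Qed.

(** Lister marks [a], [l1], [l2].  If [a] is coloured, [l1 - b - l2] is a path with one
    token at each end.  Otherwise [a] has one token and [a, l3, b, l4] is a 4-cycle, on
    which marking the edge [b l3] leads to a path of length at most two. *)
Lemma lister_K24 U a b l1 l2 l3 l4 : {subset [:: a; b; l1; l2; l3; l4] <= U} ->
  uniq [:: a; b; l1; l2; l3; l4] ->
  {in [:: l1; l2; l3; l4], forall l, e a l /\ e b l} ->
  lister_wins e 5 U (fun=> 2).
Proof.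
move=> sU; rewrite /= !inE !negb_or andbT.
move=> /and5P[/and5P[ab a1 a2 a3 a4] /and4P[b1 b2 b3 b4] /and3P[l12 l13 l14]
             /andP[l23 l24] l34] adj.
have [[ea1 eb1] [ea2 eb2] [ea3 eb3] [ea4 eb4]] :
  [/\ e a l1 /\ e b l1, e a l2 /\ e b l2, e a l3 /\ e b l3 & e a l4 /\ e b l4].
  by split; apply: adj; rewrite !inE eqxx ?orbT.
have inU z : z \in [:: a; b; l1; l2; l3; l4] -> z \in U by exact: sU.
have cV : #|[set a; l1; l2]| = 3 by rewrite -setUA cardsU1 cards2 !inE negb_or a1 a2 l12.
have sp2 V v : spend V (fun=> 2) v <= 2 by exact: leq_subr.
apply: (@Marking _ _ _ _ _ [set a; l1; l2]); rewrite ?cV //.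
  apply/subsetP => z; rewrite !inE => /orP[/pred2P[]|/eqP]->;
  by apply: inU; rewrite !inE eqxx ?orbT.
move=> X sX iX; rewrite (_ : 5 - 2 = 3) //.
have nX z : z \notin [set a; l1; l2] -> z \notin X by apply: contra; exact: subsetP.
have bX : b \notin X by apply: nX; rewrite !inE !negb_or eq_sym ab b1 b2.
have [aX|aX] := boolP (a \in X).
  have l1X : l1 \notin X by apply/negP => /(iX _ _ aX); rewrite ea1.
  have l2X : l2 \notin X by apply/negP => /(iX _ _ aX); rewrite ea2.
  apply: lister_wins_mono (@lister_path l1 [:: b; l2] _ _ _ _ _ _ (sp2 _) _ _) => //=.
  - move=> z; rewrite !inE => /or3P[]/eqP->; rewrite ?l1X ?l2X ?bX;
    by apply: inU; rewrite !inE eqxx ?orbT.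
  - by rewrite e_sym eb1 eb2.
  - by rewrite !inE negb_or eq_sym b1 l12 b2.
  - by rewrite /spend !inE eqxx !orbT.
  - by rewrite /spend !inE eqxx !orbT.
have l3X : l3 \notin X by apply: nX; rewrite !inE !negb_or eq_sym a3 eq_sym l13 eq_sym l23.
have l4X : l4 \notin X by apply: nX; rewrite !inE !negb_or eq_sym a4 eq_sym l14 eq_sym l24.
have fa : spend [set a; l1; l2] (fun=> 2) a <= 1 by rewrite /spend !inE eqxx.
have inUX z : z \in [:: a; b; l3; l4] -> z \in U :\: X.
  rewrite !inE => /or4P[]/eqP->; rewrite ?aX ?bX ?l3X ?l4X;
  by apply: inU; rewrite !inE eqxx ?orbT.
apply: (@lister_edge _ _ _ b l3) => //; try by apply: inUX; rewrite !inE eqxx ?orbT.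
  move=> g le_g gl; apply: lister_wins_mono (@lister_path l3 [:: a] _ g _ _ _ _ _ _ _) => //=.
  - move=> z; rewrite in_setD1 mem_seq2 => /pred2P[]->.
      by rewrite eq_sym b3 inUX // !inE eqxx ?orbT.
    by rewrite ab inUX // !inE eqxx ?orbT.
  - by rewrite e_sym ea3.
  - by rewrite !inE eq_sym a3.
  - by move=> v; exact: leq_trans (le_g v) (sp2 _ _).
  - by move: (sp2 [set a; l1; l2] l3) gl; clear; lia.
  - exact: leq_trans (le_g _) fa.
move=> g le_g gl; apply: lister_wins_mono (@lister_path b [:: l4; a] _ g _ _ _ _ _ _ _) => //=.
- move=> z; rewrite in_setD1 mem_seq3 => /or3P[]/eqP->.
  + by rewrite b3 inUX // !inE eqxx ?orbT.
  + by rewrite eq_sym l34 inUX // !inE eqxx ?orbT.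
  + by rewrite a3 inUX // !inE eqxx ?orbT.
- by rewrite eb4 e_sym ea4.
- by rewrite !inE negb_or b4 eq_sym ab eq_sym a4.
- by move=> v; exact: leq_trans (le_g v) (sp2 _ _).
- by move: (sp2 [set a; l1; l2] b) gl; clear; lia.
- exact: leq_trans (le_g _) fa.
Qed.

End ListerStrategies.

(** * Strategies for Painter *)

Section PainterStrategies.

Variables (T : finType) (e : rel T).
Hypotheses (e_sym : symmetric e) (e_irr : irreflexive e).
Implicit Types (U V X : {set T}) (f g : T -> nat) (D : seq T).

Lemma independent1 x : independent e [set x].
Proof. by move=> y z /set1P-> /set1P->; rewrite e_irr. Qed.

Lemma independent0 : independent e set0.
Proof. by move=> y z; rewrite inE. Qed.

Lemma painter_budget0 U f : {in U, forall v, 0 < f v} -> ~ lister_wins e 0 U f.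
Proof. by move=> fpos; apply: painter_step => // V _; case: #|V| => [|[]]. Qed.

Lemma painter_independent b U f :
  {in U, forall v, 0 < f v} -> independent e U -> ~ lister_wins e b U f.
Proof.
move=> fpos iU.
apply: (painter_invariant (I := fun b U f => {in U, forall v, 0 < f v} /\ independent e U)) => //.
  by move=> ? ? ? [].
move=> {}b {}U {}f V [{}fpos {}iU] sVU _; exists V; split=> //.
  by move=> x y /(subsetP sVU) xU /(subsetP sVU); exact: iU.
split=> [v|x y]; last by move=> /setDP[xU _] /setDP[yU _]; exact: iU.
by move=> /setDP[vU vV]; rewrite /spend (negPf vV) subn0 fpos.
Qed.

Lemma deg_in_mono U U' v : U \subset U' -> deg_in e U v <= deg_in e U' v.
Proof.
move=> sU; apply: subset_leq_card; apply/subsetP => w; rewrite !inE => /andP[wU ->].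
by rewrite (subsetP sU).
Qed.

(** Painter follows the strategy for the graph without [v] and adds [v] whenever it is
    marked and no neighbour is being coloured.  Each round in which [v] is blocked
    removes one of its neighbours, and it has more tokens than neighbours. *)
Lemma painter_peel b U f v :
  deg_in e U v < f v -> ~ lister_wins e b (U :\ v) f -> ~ lister_wins e b U f.
Proof.
move=> dv nw; apply: (painter_invariant (I := fun b U f =>
   ~ lister_wins e b (U :\ v) f /\ (v \in U -> deg_in e U v < f v))) => //.
  move=> {}b {}U {}f [{}nw {}dv] u uU; have [E|uv] := eqVneq u v.
    by move: dv; rewrite -E => /(_ uU); case: (f u).
  by apply: (painter_fed nw); rewrite !inE uv.
move=> {dv nw}b {}U {}f V [nw dv] sVU /andP[_ cV].
have leW : #|V :\ v| <= #|V| by rewrite subset_leq_card ?subD1set.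
have [X [sX iX nwX]] := painter_answer e_irr nw (setSD _ sVU) (leq_trans leW cV).
have next (Y : {set T}) : X \subset Y -> Y \subset V ->
    ~ lister_wins e (b - #|V|.-1) ((U :\: Y) :\ v) (spend V f).
  move=> sXY sYV w; apply: nwX; apply: lister_wins_mono w; first by lia.
    apply/subsetP => x; rewrite !inE => /and3P[-> xY ->]; rewrite !andbT.
    by apply: contra xY; exact: subsetP.
  by move=> x /setD1P[xv _]; rewrite /spend !inE xv.
have sXV : X \subset V by apply: subset_trans sX (subD1set _ _).
have [/andP[vV /exists_inPn Xv]|] := boolP ((v \in V) && ~~ [exists x in X, e v x]).
  exists (v |: X); split.
  - by rewrite subUset sub1set vV.
  - move=> x y /setU1P[->|xX] /setU1P[->|yX]; rewrite ?e_irr ?Xv //; last exact: iX.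
    by rewrite e_sym Xv.
  - split; last by rewrite !inE eqxx.
    by apply: next; rewrite ?subsetUr // subUset sub1set vV.
rewrite negb_and negbK => vX; exists X; split=> //.
split; first exact: next.
move=> /setDP[vU vnX]; have := dv vU; rewrite /spend.
case: (boolP (v \in V)) vX => [vV /existsP[x /andP[xX evx]]|_ _]; last first.
  by rewrite subn0; apply: leq_ltn_trans; apply: deg_in_mono; apply: subsetDl.
have lt_deg : deg_in e (U :\: X) v < deg_in e U v; last by lia.
apply: proper_card; apply/properP; split.
  by apply/subsetP => w; rewrite !inE => /andP[/andP[_ ->]].
exists x; rewrite !inE ?xX ?evx ?andbT //.
exact: subsetP sVU _ (subsetP sXV _ xX).
Qed.

(** Painter plays on the two parts separately; the excess of a round restricted to
    one part is at most its excess. *)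
Lemma painter_union b U1 U2 f : {in U1 & U2, forall x y, ~~ e x y} ->
  ~ lister_wins e b U1 f -> ~ lister_wins e b U2 f ->
  ~ lister_wins e b (U1 :|: U2) f.
Proof.
move=> ne nw1 nw2; apply: (painter_invariant (I := fun b U f => exists U1 U2,
   [/\ U = U1 :|: U2, {in U1 & U2, forall x y, ~~ e x y}, ~ lister_wins e b U1 f &
       ~ lister_wins e b U2 f])); last by exists U1, U2.
  move=> {nw1 nw2 ne}b U {}f [{}U1 [{}U2 [-> _ nw1 nw2]]] v /setUP[vU|vU].
    exact: painter_fed nw1 v vU.
  exact: painter_fed nw2 v vU.
move=> {nw1 nw2 ne}b U {}f V [{}U1 [{}U2 [-> ne nw1 nw2]]] sV /andP[_ cV].
have cI (U' : {set T}) : #|V :&: U'| <= #|V| by rewrite subset_leq_card ?subsetIl.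
have [X1 [sX1 iX1 nX1]] := painter_answer e_irr nw1 (subsetIr V U1) (leq_trans (cI _) cV).
have [X2 [sX2 iX2 nX2]] := painter_answer e_irr nw2 (subsetIr V U2) (leq_trans (cI _) cV).
have [sX1V sX1U] : X1 \subset V /\ X1 \subset U1 by apply/andP; rewrite -subsetI.
have [sX2V sX2U] : X2 \subset V /\ X2 \subset U2 by apply/andP; rewrite -subsetI.
have next (U' X : {set T}) : X \subset X1 :|: X2 ->
    ~ lister_wins e (b - #|V :&: U'|.-1) (U' :\: X) (spend (V :&: U') f) ->
    ~ lister_wins e (b - #|V|.-1) (U' :\: (X1 :|: X2)) (spend V f).
  move=> sX nX w; apply: nX; apply: lister_wins_mono w.
  - by have := cI U'; lia.
  - exact: setDS.
  - by move=> x /setDP[xU _]; rewrite /spend inE xU andbT.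
exists (X1 :|: X2); split.
- by rewrite subUset sX1V.
- move=> x y /setUP[x1|x2] /setUP[y1|y2]; first exact: iX1.
  + by apply: ne; [apply: subsetP x1 | apply: subsetP y2].
  + by rewrite e_sym; apply: ne; [apply: subsetP y1 | apply: subsetP x2].
  + exact: iX2.
exists (U1 :\: (X1 :|: X2)), (U2 :\: (X1 :|: X2)); split.
- by rewrite setDUl.
- by move=> x y /setDP[xU _] /setDP[yU _]; exact: ne.
- exact: next (subsetUl _ _) nX1.
- exact: next (subsetUr _ _) nX2.
Qed.

(** A vertex of largest rank has more tokens than neighbours and can be peeled off. *)
Lemma painter_degenerate (rho : T -> nat) b U f :
  {in U, forall v, #|[set w in U | e v w && (rho w <= rho v)]| < f v} ->
  ~ lister_wins e b U f.
Proof.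
have [m] := ubnP #|U|; elim: m U => // m IH U cU deg.
have [U0|[v0 v0U]] := set_0Vmem U.
  by apply: painter_independent => [x|x y]; rewrite U0 inE.
pose v := [arg max_(v > v0 in U) rho v].
have [vU vmax] : v \in U /\ forall w, w \in U -> rho w <= rho v.
  by rewrite /v; case: arg_maxnP.
apply: (@painter_peel _ _ _ v).
  apply: leq_ltn_trans (deg v vU); apply: subset_leq_card.
  by apply/subsetP => w; rewrite !inE => /andP[wU ->]; rewrite wU vmax.
apply: IH.
  by move: cU; rewrite (cardsD1 v U) vU.
move=> w /setD1P[_ wU]; apply: leq_ltn_trans (deg w wU); apply: subset_leq_card.
by apply/subsetP => x; rewrite !inE => /andP[/andP[_ ->]].
Qed.

Definition kernel (d : rel T) V X :=
  [/\ X \subset V, independent e X &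
      {in V :\: X, forall v, exists2 x, x \in X & d v x}].

(** Painter colours a kernel of the marked set: a marked vertex that is not coloured
    loses a token, but also an out-neighbour. *)
Lemma painter_kernel (d : rel T) b U f :
  (forall V, V \subset U -> exists X, kernel d V X) ->
  {in U, forall v, #|[set w in U | d v w]| < f v} -> ~ lister_wins e b U f.
Proof.
move=> kerU outU; apply: (painter_invariant (I := fun _ U f =>
  (forall V, V \subset U -> exists X, kernel d V X) /\
  {in U, forall v, #|[set w in U | d v w]| < f v})) => // {kerU outU}b {}U {}f.
  by move=> [_ out] v /out; case: (f v).
move=> V [kerU outU] sVU _; have [X [sX iX dX]] := kerU V sVU; exists X; split=> //.
split=> [W sW|v /setDP[vU vX]]; first by apply: kerU; apply: subset_trans sW (subsetDl _ _).
have sub : [set w in U :\: X | d v w] \subset [set w in U | d v w].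
  by apply/subsetP => w; rewrite !inE => /andP[/andP[_ ->]].
rewrite /spend; case: (boolP (v \in V)) => vV; last first.
  by rewrite subn0; apply: leq_ltn_trans (subset_leq_card sub) (outU v vU).
have [|x xX dvx] := dX v; first by rewrite inE vX.
rewrite subn1 -ltnS prednK; last by have := outU v vU; case: (f v).
apply: leq_trans (outU v vU); rewrite ltnS; apply: proper_card.
apply/properP; split=> //; exists x; rewrite !inE ?xX ?dvx ?andbT //.
by apply: subsetP (subset_trans sX sVU) x xX.
Qed.

(** A vertex of least rank dominates its in-neighbours; the others are handled by
    induction. *)
Lemma kernel_of_rank (d : rel T) (rho : T -> nat) V :
  {in V &, forall u v, e u v -> d u v || d v u} ->
  {in V &, forall u v, d u v -> rho v < rho u} ->
  exists X, kernel d V X.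
Proof.
have [m] := ubnP #|V|; elim: m V => // m IH V cV ed dr.
have [V0|[v0 v0V]] := set_0Vmem V.
  exists set0; split; [exact: sub0set | exact: independent0 | by move=> x; rewrite V0 !inE].
pose v := [arg min_(v < v0 in V) rho v].
have [vV vmin] : v \in V /\ forall w, w \in V -> rho v <= rho w.
  by rewrite /v; case: arg_minnP.
pose W := [set u in V :\ v | ~~ d u v].
have sWV : W \subset V by apply/subsetP => u; rewrite !inE => /andP[/andP[_ ->]].
have vW : v \notin W by rewrite !inE eqxx.
have [|u w uW wW|u w uW wW|X [sX iX dX]] := IH W.
- apply: leq_trans (cV : #|V| <= m); apply: proper_card; apply/properP; split=> //.
  by exists v.
- by apply: ed; apply: subsetP sWV _ _.
- by apply: dr; apply: subsetP sWV _ _.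
have nev x : x \in X -> ~~ e v x.
  move=> /(subsetP sX) xW; apply/negP => /ed; rewrite vV (subsetP sWV) //.
  move=> /(_ isT isT)/orP[/dr|dxv]; last by move: xW; rewrite !inE dxv andbF.
  by rewrite vV (subsetP sWV) // => /(_ isT isT); rewrite ltnNge vmin // (subsetP sWV).
exists (v |: X); split.
- by rewrite subUset sub1set vV (subset_trans sX).
- move=> x y /setU1P[->|xX] /setU1P[->|yX]; rewrite ?e_irr ?nev //.
    by rewrite e_sym nev.
  exact: iX.
move=> u; rewrite !inE negb_or => /andP[/andP[uv uX] uV].
have [duv|nduv] := boolP (d u v); first by exists v; rewrite ?setU11.
have [|x xX dux] := dX u; first by rewrite !inE uX uv uV.
by exists x; rewrite // inE xX orbT.
Qed.

Definition chordless D := {in D &, forall x y, e x y -> (y == next D x) || (x == next D y)}.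

Lemma index_next D x : uniq D -> x \in D -> index (next D x) D = (index x D).+1 %% size D.
Proof.
move=> uD xD; rewrite next_nth xD; case: D uD xD => // y s uD xD.
have le_i : index x (y :: s) <= size s by rewrite -ltnS -[(size s).+1]/(size (y :: s)) index_mem.
move: le_i; rewrite leq_eqVlt => /predU1P[->|lt_i].
  by rewrite nth_default // index_head modnn.
by rewrite -[nth _ s _]/(nth y (y :: s) _.+1) index_uniq // modn_small.
Qed.

(** The orientation of the cycle by [next] becomes acyclic once an unmarked vertex
    [z] is removed; the rank is the distance to [z] along the cycle. *)
Lemma cycle_kernel_proper D V z : uniq D -> chordless D ->
  V \subset [set x in D] -> z \in D -> z \notin V ->
  exists X, kernel (fun u v => v == next D u) V X.
Proof.
move=> uD chD sV; case/rot_to => i s Ez zV.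
have sVD x : x \in V -> x \in D by move/(subsetP sV); rewrite inE.
have uz : uniq (z :: s) by rewrite -Ez rot_uniq.
apply: (@kernel_of_rank _ (fun x => size D - index x (z :: s))).
  by move=> u v uV vV; apply: chD; apply: sVD.
move=> u v uV vV /eqP Ev; move: vV; rewrite {}Ev -(next_rot i) // Ez => nV.
have uzs : u \in z :: s by rewrite -Ez mem_rot sVD.
have sz : size D = (size s).+1 by rewrite -(size_rot i) Ez.
have := index_next uz uzs; rewrite sz /= => ->; move: uzs; rewrite -index_mem /= ltnS.
rewrite leq_eqVlt => /predU1P[E|lt_i]; last by rewrite modn_small //; lia.
have nz : next (z :: s) u = z.
  have zs : next (z :: s) u \in z :: s by rewrite mem_next -index_mem /= E.
  rewrite -(nth_index z zs) index_next //; last by rewrite -index_mem /= E.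
  by rewrite /= E modnn.
by move: nV; rewrite nz (negPf zV).
Qed.

Lemma cycle_kernel_even D : uniq D -> chordless D -> ~~ odd (size D) ->
  exists X, kernel (fun u v => v == next D u) [set x in D] X.
Proof.
move=> uD chD oD; exists [set x in D | odd (index x D)].
have flip x : x \in D -> odd (index (next D x) D) = ~~ odd (index x D).
  by move=> xD; rewrite index_next // odd_mod // (negPf oD).
split.
- by apply/subsetP => x; rewrite !inE => /andP[].
- move=> x y; rewrite !inE => /andP[xD ox] /andP[yD oy]; apply/negP.
  by case/(chD _ _ xD yD)/orP => /eqP E; [move: oy|move: ox]; rewrite E flip // ?ox ?oy.
move=> x; rewrite !inE negb_and => /andP[nox xD]; move: nox; rewrite xD /= => ox.
by exists (next D x) => //; rewrite inE mem_next xD flip.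
Qed.

Lemma outdeg_next D U v : #|[set w in U | w == next D v]| <= 1.
Proof.
rewrite -(cards1 (next D v)) subset_leq_card //; apply/subsetP => w.
by rewrite !inE => /andP[].
Qed.

Lemma painter_even_cycle b D : uniq D -> chordless D -> ~~ odd (size D) ->
  ~ lister_wins e b [set x in D] (fun=> 2).
Proof.
move=> uD chD oD; apply: painter_kernel => [V sV|v _]; last first.
  by rewrite ltnS; exact: outdeg_next.
have [->|] := eqVneq V [set x in D]; first exact: cycle_kernel_even.
rewrite eqEsubset sV /= => /subsetPn[z]; rewrite inE => zD zV.
exact: cycle_kernel_proper zD zV.
Qed.

(** If Lister marks the whole cycle, the budget is exhausted and every vertex still
    has a token.  Otherwise Painter colours a kernel, which breaks the cycle into
    paths directed by [next]. *)
Lemma painter_odd_cycle b D : uniq D -> chordless D -> b < size D ->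
  ~ lister_wins e b [set x in D] (fun=> 2).
Proof.
move=> uD chD ltb; apply: painter_step => // V sV /andP[V2 _].
have [->|] := eqVneq V [set x in D].
  exists set0; split; [exact: sub0set | exact: independent0 |].
  rewrite cardsE (card_uniqP uD) (_ : b - _ = 0); last by lia.
  by apply: painter_budget0 => v _; rewrite /spend; case: (_ \in _).
rewrite eqEsubset sV /= => /subsetPn[z]; rewrite inE => zD zV.
have [X [sX iX dX]] := cycle_kernel_proper uD chD sV zD zV.
exists X; split=> //; apply: (@painter_kernel (fun u v => v == next D u)) => [W sW|v /setDP[vD vX]].
  have [x xX] : exists x, x \in X.
    have [v vV] : exists v, v \in V by apply/card_gt0P; exact: ltnW.
    have [vX|vX] := boolP (v \in X); first by exists v.
    by have [|x xX _] := dX v; [rewrite inE vX | exists x].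
  apply: (@cycle_kernel_proper _ _ x) => //.
  - exact: subset_trans sW (subsetDl _ _).
  - by have := subsetP sV _ (subsetP sX _ xX); rewrite inE.
  - by apply/negP => /(subsetP sW); rewrite inE xX.
rewrite /spend; case: (boolP (v \in V)) => vV; last by rewrite subn0 ltnS outdeg_next.
have [|x xX /eqP nx] := dX v; first by rewrite inE vX.
rewrite subn1 /= ltnS leqn0 cards_eq0; apply/eqP/setP => w; rewrite !inE.
by apply/negP => /andP[/andP[wX _] /eqP E]; move: wX; rewrite E -nx xX.
Qed.

(** The marked vertices that have their last token are pairwise nonadjacent, and
    Painter colours all of them; the round exhausts the budget. *)
Lemma painter_budget1 U f : {in U, forall v, 0 < f v} ->
  {in U &, forall x y, f x <= 1 -> f y <= 1 -> ~~ e x y} ->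
  ~ lister_wins e 1 U f.
Proof.
move=> fpos ne; apply: painter_step => // V sV /andP[V2 _].
have sVU x : x \in V -> x \in U by exact: subsetP.
exists [set v in V | f v <= 1]; split.
- by apply/subsetP => x; rewrite inE => /andP[].
- by move=> x y; rewrite !inE => /andP[xV fx] /andP[yV fy]; rewrite ne ?sVU.
rewrite (_ : _ - _ = 0); last by lia.
apply: painter_budget0 => v; rewrite /spend !inE => /andP[] + vU; have := fpos v vU.
by case: (v \in V) => /=; lia.
Qed.

(** A triple exhausts the budget.  After a pair, of which Painter colours one vertex,
    a single vertex is down to one token. *)
Lemma painter_budget2 U : ~ lister_wins e 2 U (fun=> 2).
Proof.
apply: painter_step => // V sV; rewrite leq_eqVlt => /andP[/predU1P[V2|V3] V3'].
  have /cards2P[x [y [xy EV]]] : #|V| == 2 by rewrite -V2.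
  rewrite EV; exists [set x]; split.
  - by rewrite sub1set !inE eqxx.
  - exact: independent1.
  rewrite cards2 xy; apply: painter_budget1 => [v _|u v]; rewrite /spend; first by case: (_ \in _).
  have only w : w \in U :\: [set x] -> 2 - (w \in [set x; y]) <= 1 -> w = y.
    by rewrite !inE => /andP[/negPf-> _] /=; case: eqP.
  by move=> uU vU /(only u uU)-> /(only v vU)->; rewrite e_irr.
exists set0; split; [exact: sub0set | exact: independent0 |].
rewrite (_ : _ - _ = 0); last by lia.
by apply: painter_budget0 => v _; rewrite /spend; case: (_ \in _).
Qed.

End PainterStrategies.

(** * Painter on complete bipartite graphs with a part of size two *)

Section TwoCentres.

Variables (T : finType) (e : rel T).
Hypotheses (e_sym : symmetric e) (e_irr : irreflexive e).
Implicit Types (a b v : T) (U V X : {set T}) (f : T -> nat).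

(** Covers all subgraphs of [K_{2,m}] with centres [a] and [b]: missing edges and
    centres only help Painter, and this way the notion passes to subsets. *)
Definition two_centred a b U :=
  {in U &, forall x y, e x y -> (x \in [set a; b]) != (y \in [set a; b])}.

Lemma two_centredC a b U : two_centred a b U -> two_centred b a U.
Proof. by rewrite /two_centred setUC. Qed.

Lemma two_centredD a b U X : two_centred a b U -> two_centred a b (U :\: X).
Proof. by move=> tc x y /setDP[xU _] /setDP[yU _]; exact: tc. Qed.

Lemma painter_star m a b U f : two_centred a b U -> a \notin U -> 1 < f b ->
  {in U, forall v, 0 < f v} -> #|[set v in U | f v <= 1]| <= 1 ->
  ~ lister_wins e m U f.
Proof.
move=> tc aU fb fpos one.
apply: (@painter_degenerate _ _ e_sym e_irr
  (fun v => if v == b then 1 else if f v <= 1 then 0 else 2)).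
move=> v vU; have [->|vb] := eqVneq v b.
  apply: leq_ltn_trans fb; apply: leq_trans one; apply: subset_leq_card.
  apply/subsetP => w; rewrite !inE => /and3P[-> ebw]; have [wb|_] := eqVneq w b.
    by move: ebw; rewrite wb e_irr.
  by case: ifP.
have va : v != a by apply: contraNneq aU => <-.
have nb w : w \in U -> e v w -> w = b.
  move=> wU evw; have := tc _ _ vU wU evw; rewrite !inE (negPf vb) (negPf va) /=.
  have [wa|_] := eqVneq w a; last by case: (w =P b).
  by move: aU; rewrite -wa wU.
case: ifP => fv.
  rewrite (_ : [set _ in _ | _] = set0) ?cards0 ?fpos //.
  apply/setP => w; rewrite !inE; apply/negP => /and3P[wU evw].
  by rewrite (nb w) // eqxx.
apply: (@leq_ltn_trans 1); last by rewrite ltnNge fv.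
rewrite -(cards1 b); apply: subset_leq_card; apply/subsetP => w.
by rewrite !inE => /and3P[wU evw _]; apply/eqP/nb.
Qed.

Lemma painter_short_path m a b U f : two_centred a b U -> a != b ->
  #|U :\: [set a; b]| <= 1 -> {in U, forall v, 0 < f v} ->
  {in U, forall v, v != a -> 1 < f v} -> ~ lister_wins e m U f.
Proof.
move=> tc ab cL fpos f2.
apply: (@painter_degenerate _ _ e_sym e_irr
  (fun v => if v == a then 0 else if v == b then 2 else 1)).
move=> v vU; have [va|va] := eqVneq v a.
  rewrite (_ : [set _ in _ | _] = set0) ?cards0 ?fpos //.
  apply/setP => w; rewrite !inE; apply/negP => /and3P[wU evw].
  by case: eqP => [wa|_]; [move: evw; rewrite va wa e_irr | case: eqP].
apply: leq_ltn_trans (f2 v vU va); have [vb|vb] := eqVneq v b.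
  apply: leq_trans cL; apply: subset_leq_card; apply/subsetP => w.
  rewrite !inE => /and3P[wU evw _]; rewrite wU andbT.
  by have := tc _ _ vU wU evw; rewrite !inE vb eqxx orbT; case: (_ || _).
rewrite -[leqRHS](cards1 a); apply: subset_leq_card; apply/subsetP => w.
rewrite !inE => /and3P[wU evw]; have := tc _ _ vU wU evw.
by rewrite !inE (negPf va) (negPf vb); case: (w =P a) => // _; case: (w =P b).
Qed.

(** A triple exhausts the budget, and Painter only has to colour [a] if it is marked.
    After a pair, Painter colours [a] if it is marked, or else the marked leaves; the
    vertices with one token are then pairwise nonadjacent. *)
Lemma painter_two_centres_budget2 a b U f : two_centred a b U ->
  {in U, forall v, 0 < f v} -> {in U, forall v, v != a -> 1 < f v} ->
  ~ lister_wins e 2 U f.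
Proof.
move=> tc fpos f2; apply: painter_step => // V sV; rewrite leq_eqVlt => /andP[/predU1P[V2|V3] V3'].
  rewrite -V2; have [aV|aV] := boolP (a \in V).
    exists [set a]; split; [by rewrite sub1set | exact: independent1 |].
    have V1 : #|V :\ a| <= 1 by move: V2; rewrite (cardsD1 a V) aV; lia.
    apply: painter_budget1 => [v /setD1P[va vU]|x y].
      by have := f2 v vU va; rewrite /spend; case: (v \in V) => /=; lia.
    have only v : v \in U :\ a -> spend V f v <= 1 -> v \in V :\ a.
      move=> /setD1P[va vU]; have := f2 v vU va; rewrite /spend inE !inE va.
      by case: (v \in V) => //=; lia.
    move=> xU yU /(only x xU) xV /(only y yU) yV.
    by move/card_le1_eqP: V1 => /(_ _ _ xV yV)->; rewrite e_irr.
  have iVb : independent e (V :\ b).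
    move=> x y /setD1P[xb xV] /setD1P[yb yV]; apply/negP => exy.
    have := tc _ _ (subsetP sV _ xV) (subsetP sV _ yV) exy.
    rewrite !inE (negPf xb) (negPf yb) !orbF.
    have /negPf-> : x != a by apply: contraNneq aV => <-.
    by have /negPf-> : y != a by apply: contraNneq aV => <-.
  exists (V :\ b); split => //; first exact: subD1set.
  have inU v : v \in U :\: (V :\ b) -> v \in U /\ (v \in V -> v = b).
    by rewrite !inE => /andP[+ ->]; case: eqP => // _; case: (v \in V).
  have poor v : v \in U :\: (V :\ b) -> spend V f v <= 1 -> v \in [set a; b].
    move=> /inU[vU vb]; rewrite /spend !inE; have [//|va] := eqVneq v a.
    by have := f2 v vU va; case: (boolP (v \in V)) => [/vb->|] //=; rewrite ?eqxx //; lia.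
  apply: painter_budget1 => [v /inU[vU vb]|x y xU yU /(poor x xU) xc /(poor y yU) yc].
    rewrite /spend; have := fpos v vU; case: (boolP (v \in V)) => [vV|_] /=; last by lia.
    have va : v != a by apply: contraNneq aV => <-.
    by have := f2 v vU va; lia.
  apply/negP => exy; have := tc x y; rewrite xc yc.
  by case: (inU x xU) => xU' _; case: (inU y yU) => yU' _; move/(_ xU' yU' exy).
rewrite (_ : _ - _ = 0); last by lia.
pose X := V :&: [set a]; exists X; split; first exact: subsetIl.
  by move=> x y /setIP[_ /set1P->] /setIP[_ /set1P->]; rewrite e_irr.
apply: painter_budget0 => v; rewrite !inE negb_and => /andP[vX vU].
rewrite /spend; have := fpos v vU; case: (boolP (v \in V)) vX => [vV /= va|_ _] /=; last by lia.
by have := f2 v vU va; lia.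
Qed.

(** If at most one leaf is marked, colouring [a] leaves a star in which one leaf has
    lost a token.  Otherwise Painter colours the marked leaves, and [a] keeps one
    token: at most one leaf remains, or the budget is down to 2. *)
Lemma painter_marked_centre m a b U V : two_centred a b U -> a != b ->
  V \subset U -> a \in V -> b \notin V ->
  (#|V| <= 2) || (#|U :\: [set a; b]| <= #|V|) || (m <= 2) ->
  exists X, [/\ X \subset V, independent e X &
    ~ lister_wins e m (U :\: X) (spend V (fun=> 2))].
Proof.
move=> tc ab sV aV bV cV.
have cVa : #|V| = #|V :\ a|.+1 by rewrite (cardsD1 a V) aV.
have fpos v : 0 < spend V (fun=> 2) v by rewrite /spend; case: (v \in V).
have [V2|V2] := leqP #|V| 2.
  exists [set a]; split; [by rewrite sub1set | exact: independent1 |].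
  apply: (@painter_star _ a b) => //.
  - exact: two_centredD.
  - by rewrite !inE eqxx.
  - by rewrite /spend (negPf bV).
  have V1 : #|V :\ a| <= 1 by lia.
  apply: leq_trans V1; apply: subset_leq_card; apply/subsetP => v.
  by rewrite !inE /spend; case: (v \in V); rewrite ?andbF // => /andP[/andP[->]].
have L_V x : x \in V :\ a -> x \notin [set a; b].
  move=> /setD1P[xa xV]; rewrite !inE (negPf xa) /=.
  by apply: contraNneq bV => <-.
have iX : independent e (V :\ a).
  move=> x y xV yV; apply/negP => exy.
  have /setD1P[_ xV'] := xV; have /setD1P[_ yV'] := yV.
  have := tc _ _ (subsetP sV _ xV') (subsetP sV _ yV') exy.
  by rewrite (negPf (L_V _ xV)) (negPf (L_V _ yV)).
have rich : {in U :\: (V :\ a), forall v, v != a -> 1 < spend V (fun=> 2) v}.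
  by move=> v; rewrite !inE /spend => /andP[+ _] va; rewrite va /=; case: (v \in V).
exists (V :\ a); split=> //; first exact: subD1set.
have [m2|m2] := leqP m 2.
  move=> w; apply: (@painter_two_centres_budget2 a b (U :\: (V :\ a)) (spend V (fun=> 2))) => //.
    exact: two_centredD.
  exact: lister_wins_mono w.
apply: (@painter_short_path _ a b) => //; first exact: two_centredD.
have sVL : V :\ a \subset U :\: [set a; b].
  apply/subsetP => x xV; rewrite inE L_V //=; apply: subsetP sV _ _.
  by case/setD1P: xV.
rewrite setDDl setUC -setDDl cardsD (setIidPr sVL).
by move: cV; rewrite leqNgt V2 [m <= 2]leqNgt m2 orbF /=; lia.
Qed.

(** If both centres are marked, colouring them leaves only isolated vertices, which
    have a token left. *)
Lemma painter_marked_centres m a b U V : two_centred a b U -> a != b ->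
  V \subset U -> 2 <= #|V| ->
  (#|U :\: [set a; b]| <= 3) || (#|U :\: [set a; b]| <= 4) && (m + #|V| <= 5) ->
  ~ (V \subset U :\: [set a; b]) ->
  exists X, [/\ X \subset V, independent e X &
    ~ lister_wins e m (U :\: X) (spend V (fun=> 2))].
Proof.
move=> tc ab sV V2 cL nsV.
have cV : (#|V| <= 2) || (#|U :\: [set a; b]| <= #|V|) || (m <= 2) by move: cL; lia.
have [aV|aV] := boolP (a \in V); have [bV|bV] := boolP (b \in V).
- exists [set a; b]; split.
  + by apply/subsetP => x /set2P[]->.
  + move=> x y xc yc; apply/negP => exy; have := tc x y; rewrite xc yc.
    suff inU z : z \in [set a; b] -> z \in U by move/(_ (inU _ xc) (inU _ yc) exy).
    by move=> /set2P[]->; apply: subsetP sV _ _.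
  apply: painter_independent => [v _|x y /setDP[xU xc] /setDP[yU yc]].
    by rewrite /spend; case: (v \in V).
  by apply/negP => /(tc _ _ xU yU); rewrite (negPf xc) (negPf yc).
- exact: (painter_marked_centre tc).
- apply: (painter_marked_centre (two_centredC tc)) => //; first by rewrite eq_sym.
  by rewrite (setUC [set b]).
case: nsV; apply/subsetP => x xV; rewrite inE (subsetP sV) // andbT !inE negb_or.
by apply/andP; split; [apply: contraNneq aV | apply: contraNneq bV] => <-.
Qed.

Lemma painter_unmarked_centres m a b U V : two_centred a b U -> a != b ->
  V \subset U :\: [set a; b] -> #|U :\: [set a; b]| <= #|V|.+1 ->
  ~ lister_wins e m (U :\: V) (spend V (fun=> 2)).
Proof.
move=> tc ab sV cV.
have rich : {in U :\: V, forall v, 1 < spend V (fun=> 2) v}.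
  by move=> v /setDP[_ vV]; rewrite /spend (negPf vV).
apply: (@painter_short_path _ a b) => //; first exact: two_centredD.
- by rewrite setDDl setUC -setDDl cardsD (setIidPr sV); lia.
- by move=> v /rich; exact: ltnW.
- by move=> v /rich.
Qed.

Lemma independent_leaves a b U V : two_centred a b U ->
  V \subset U :\: [set a; b] -> independent e V.
Proof.
move=> tc sV x y /(subsetP sV)/setDP[xU xc] /(subsetP sV)/setDP[yU yc].
by apply/negP => /(tc _ _ xU yU); rewrite (negPf xc) (negPf yc).
Qed.

(** When only leaves are marked there are at least two of them; they are all coloured,
    and at most one leaf remains. *)
Lemma painter_K23 m a b U : two_centred a b U -> a != b ->
  #|U :\: [set a; b]| <= 3 -> ~ lister_wins e m U (fun=> 2).
Proof.
move=> tc ab cL; apply: painter_step => // V sV /andP[V2 _].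
have [sVL|/negP nsV] := boolP (V \subset U :\: [set a; b]); last first.
  by apply: (painter_marked_centres tc) nsV; rewrite ?cL.
exists V; split=> //; first exact: independent_leaves tc sVL.
by apply: (painter_unmarked_centres tc) => //; lia.
Qed.

(** When only leaves are marked, they are all coloured and [painter_K23] applies. *)
Lemma painter_K24 a b U : two_centred a b U -> a != b ->
  #|U :\: [set a; b]| <= 4 -> ~ lister_wins e 4 U (fun=> 2).
Proof.
move=> tc ab cL; apply: painter_step => // V sV /andP[V2 V5].
have [sVL|/negP nsV] := boolP (V \subset U :\: [set a; b]); last first.
  by apply: (painter_marked_centres tc) nsV => //; lia.
exists V; split=> //; first exact: independent_leaves tc sVL.
move=> w; apply: (@painter_K23 (4 - #|V|.-1) a b (U :\: V)) => //.
- exact: two_centredD.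
- by rewrite setDDl setUC -setDDl cardsD (setIidPr sVL); lia.
apply: lister_wins_mono w => // v /setDP[_ vV].
by rewrite /spend (negPf vV).
Qed.

End TwoCentres.

(** * Paths and edges outside a cycle *)

Section Structure.

Variables (T : finType) (e : rel T).
Hypotheses (e_sym : symmetric e) (e_irr : irreflexive e).
Implicit Types (U V X W : {set T}) (f g : T -> nat) (D p q : seq T).

Definition is_cycle D := [/\ uniq D, cycle e D & 2 < size D].

Lemma other_neighbour U v y : 2 <= deg_in e U v -> exists u, [/\ u \in U, e v u & u != y].
Proof.
rewrite /deg_in (cardsD1 y) => deg2.
have /card_gt0P[u] : 0 < #|[set w in U | e v w] :\ y| by move: deg2; case: (_ \in _) => /=; lia.
by rewrite !inE => /and3P[uy uU evu]; exists u.
Qed.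

Lemma maximal_path W x p : path e x p -> uniq (x :: p) -> {subset x :: p <= W} ->
  exists q, [/\ path e x (p ++ q), uniq (x :: p ++ q), {subset x :: p ++ q <= W} &
     forall z, z \in W -> e (last x (p ++ q)) z -> z \in x :: p ++ q].
Proof.
have [m] := ubnP (#|W| - size p); elim: m p => // m IH p lt_m pp up sp.
have [[z [zW ez zp]]|nz] :=
  pselect (exists z, [/\ z \in W, e (last x p) z & z \notin x :: p]); last first.
  exists [::]; rewrite cats0; split=> // z zW ez; apply/negPn/negP => zp.
  by apply: nz; exists z.
have upz : uniq (x :: rcons p z) by rewrite -rcons_cons rcons_uniq zp.
have spz : {subset x :: rcons p z <= W}.
  by move=> y; rewrite -rcons_cons mem_rcons inE => /predU1P[->|/sp].
have szp : size p < #|W|.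
  have : size (x :: p) <= #|W|.
    by rewrite -(card_uniqP up) subset_leq_card //; apply/subsetP.
  by [].
have [||||q] := IH (rcons p z) => //; first by rewrite size_rcons; lia.
  by rewrite rcons_path pp.
by rewrite cat_rcons => Hq; exists (z :: q).
Qed.

Lemma path_back x p d : path e x p -> e x d ->
  path e (last x p) (rcons (rev (belast x p)) d).
Proof.
move=> pp exd; rewrite rcons_path; apply/andP; split.
  by rewrite rev_path -(eq_path (e := e)) // => y z; rewrite e_sym.
by case: p {pp} => //= y p; rewrite rev_cons last_rcons.
Qed.

Lemma mem_path_back x p d : rcons (rev (belast x p)) d =i d :: belast x p.
Proof. by move=> z; rewrite mem_rcons !inE mem_rev. Qed.

(** Among the vertices outside [D], extend a path that starts next to [D] until it is
    maximal, and let [y], [z] be its last two vertices.  By maximality the other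
    neighbour of [z] lies on [D] or earlier on the path.  So [z] reaches [D] without
    [y], and [y] reaches [D] along the path without [z]. *)
Lemma lister_edge_outside_cycle U D a b : (forall v, v \in U -> 2 <= deg_in e U v) ->
  (forall v, v \in U -> exists q, [/\ path e v q, {subset q <= U} & last v q \in D]) ->
  {subset D <= U} -> is_cycle D -> 4 <= size D ->
  a \in U -> b \in U -> a \notin D -> b \notin D -> e a b ->
  lister_wins e (#|U| - 2) U (fun=> 2).
Proof.
move=> deg2 conn sD [uD cD _] szD aU bU aD bD eab.
have [x1 [x2 [d [[x1U x1D] [x2U x2D] e12 dD e1d]]]] : exists x1 x2 d,
    [/\ x1 \in U /\ x1 \notin D, x2 \in U /\ x2 \notin D, e x1 x2, d \in D & e x1 d].
  have [q [pq sq lq]] := conn a aU.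
  elim: q a b aU bU aD bD eab pq sq lq => [|c q IH] a b aU bU aD bD eab /=.
    by rewrite (negPf aD).
  move=> /andP[eac pq] sq lq; have [cD'|cD'] := boolP (c \in D).
    by exists a, b, c.
  apply: (IH c a) => //; rewrite 1?e_sym //; first by rewrite sq ?mem_head.
  by move=> z zq; rewrite sq // inE zq orbT.
pose W := U :\: [set x in D].
have WE z : z \in W = (z \notin D) && (z \in U) by rewrite !inE.
have [q [q0 pz uz sz]] : exists q, [/\ q != [::], path e x1 q, uniq (x1 :: q),
    {subset x1 :: q <= W} &
    forall z, z \in W -> e (last x1 q) z -> z \in x1 :: q].
  have [|||q [pq uq sq maxq]] := @maximal_path W x1 [:: x2].
  - by rewrite /= e12.
  - by rewrite /= inE (edge_neq e_irr).
  - by move=> z; rewrite !inE => /pred2P[]->; rewrite ?x1D ?x2D.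
  by exists (x2 :: q).
case/lastP: q q0 pz uz sz => // p z _ pz uz sz; rewrite last_rcons => maxz.
move: pz; rewrite rcons_path; set y := last x1 p => /andP[pp eyz].
have [up zp] : uniq (x1 :: p) /\ z \notin x1 :: p.
  by move: uz; rewrite -rcons_cons rcons_uniq => /andP[].
have sp v : v \in x1 :: p -> v \in W.
  by move=> vp; apply: sz; rewrite -rcons_cons mem_rcons inE vp orbT.
have yp : y \in x1 :: p by exact: mem_last.
have zW : z \in W by apply: sz; rewrite -rcons_cons mem_rcons inE eqxx.
have sW v : v \in W -> v \in U by rewrite WE => /andP[].
have nW v : v \in W -> v \notin D by rewrite WE => /andP[].
have dz : d \notin W by rewrite WE dD.
have sub_bel r v : v \in belast x1 r -> v \in x1 :: r by exact: mem_belast.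
have avoid v : v \in W -> d != v by move=> vW; apply: contraNneq dz => ->.
have [u [uU ezu uy]] := other_neighbour y (deg2 z (sW _ zW)).
have [qa [pa sa la]] : exists qa, [/\ path e z qa, {subset qa <= U :\ y} & last z qa \in D].
  have [uD'|uD'] := boolP (u \in D).
    exists [:: u]; split; rewrite //= ?ezu // => v; rewrite inE => /eqP->.
    by rewrite !inE uy.
  have up' : u \in x1 :: p.
    have := maxz u; rewrite WE uD' uU => /(_ isT ezu).
    rewrite -rcons_cons mem_rcons inE => /predU1P[E|//].
    by move: ezu; rewrite E e_irr.
  have [p1 [p2 [Ep lp1]]] : exists p1 p2, p = p1 ++ p2 /\ last x1 p1 = u.
    by case/splitPl: up' => p1 p2; exists p1, p2.
  have yp2 : y \in p2.
    rewrite /y Ep last_cat lp1; move: uy; rewrite /y Ep last_cat lp1.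
    by case: (p2) => [|c r]; rewrite ?eqxx // => _; exact: (mem_last c r).
  have yp1 v : v \in x1 :: p1 -> v != y.
    move=> vp1; apply: contraTneq yp2 => <-; apply/negP => vp2.
    by move: up; rewrite Ep -cat_cons cat_uniq => /and3P[_ /hasPn/(_ v vp2)]; rewrite vp1.
  exists (u :: rcons (rev (belast x1 p1)) d); split.
  - by rewrite /= ezu -lp1 path_back //; move: pp; rewrite Ep cat_path => /andP[].
  - move=> v; rewrite inE mem_path_back inE => /or3P[/eqP->|/eqP->|/sub_bel vp].
    + by rewrite !inE uy.
    + by rewrite !inE avoid ?sp // sD.
    + by rewrite !inE yp1 // sW // sp // Ep -cat_cons mem_cat vp.
  - by rewrite /= last_rcons.
apply: (@lister_edge_off_cycle _ _ e_sym e_irr U z y D qa (rcons (rev (belast x1 p)) d)) => //.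
- exact: sW.
- exact/sW/sp.
- by rewrite e_sym.
- exact: nW.
- exact/nW/sp.
- exact: path_back.
- move=> v; rewrite mem_path_back !inE => /predU1P[->|/sub_bel vp].
    by rewrite avoid // sD.
  by rewrite sW ?sp // andbT; apply: contraNneq zp => <-.
- by rewrite last_rcons.
Qed.

End Structure.

(** * Shortest cycles *)

Section Cycles.

Variables (T : finType) (e : rel T).
Hypotheses (e_sym : symmetric e) (e_irr : irreflexive e).
Implicit Types (U V X W : {set T}) (D A B : seq T).

Local Notation is_cycle := (is_cycle e).

Lemma odd_is_cycle D : uniq D -> cycle e D -> odd (size D) -> is_cycle D.
Proof.
move=> uD cD oD; split=> //; case: D cD oD {uD} => [|x [|y [|z D]]] //=.
by rewrite e_irr.
Qed.

(** The last vertex of a maximal path has a second neighbour, which lies on the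
    path. *)
Lemma exists_cycle U v0 : v0 \in U -> (forall v, v \in U -> 2 <= deg_in e U v) ->
  exists D, is_cycle D /\ {subset D <= U}.
Proof.
move=> v0U deg2; have [|||p [pp up sp maxp]] := @maximal_path _ e U v0 [::] => //.
  by move=> z; rewrite inE => /eqP->.
rewrite cat0s in pp up sp maxp; case/lastP: p pp up sp maxp => [|p z] pz uz sz maxz.
  have [u [uU evu uv]] := other_neighbour v0 (deg2 _ v0U).
  by have := maxz _ uU evu; rewrite inE (negPf uv).
rewrite last_rcons in maxz; move: pz; rewrite rcons_path => /andP[pp eyz].
have zU : z \in U by apply: sz; rewrite -rcons_cons mem_rcons inE eqxx.
have [u [uU ezu uy]] := other_neighbour (last v0 p) (deg2 z zU).
have up : u \in v0 :: p.
  have := maxz u uU ezu; rewrite -rcons_cons mem_rcons inE => /predU1P[E|//].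
  by move: ezu; rewrite E e_irr.
have [p1 [p2 [Ep lp1]]] : exists p1 p2, p = p1 ++ p2 /\ last v0 p1 = u.
  by case/splitPl: up => p1 p2; exists p1, p2.
move: pp uz eyz uy sz; rewrite Ep last_cat cat_path lp1 rcons_cat -cat_cons.
move=> /andP[_ pp2] uz eyz uy sz.
exists (u :: rcons p2 z); split; last first.
  move=> x; rewrite inE => /predU1P[->//|xp]; apply: sz.
  by rewrite mem_cat xp orbT.
split.
- move: uz; rewrite cat_uniq => /and3P[_ /hasPn dis up2].
  rewrite cons_uniq up2 andbT; apply/negP => /dis; rewrite /= -lp1.
  by rewrite mem_last.
- by rewrite /= !rcons_path pp2 last_rcons eyz.
- by rewrite /= size_rcons; case: (p2) uy => //=; rewrite eqxx.
Qed.

Lemma cycle_split D x y : is_cycle D -> x \in D -> y \in D -> x != y ->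
  exists A B, [/\ is_cycle (x :: A ++ y :: B), D =i x :: A ++ y :: B,
    size D = (size A + size B).+2 & next D =1 next (x :: A ++ y :: B)].
Proof.
move=> [uD cD szD] xD yD xy; case/rot_to: xD => i s Es.
have : y \in x :: s by rewrite -Es mem_rot.
rewrite inE eq_sym (negPf xy) /= => ys.
case/splitPr: ys Es => A B Es; exists A, B; rewrite -Es; split.
- by split; rewrite ?rot_uniq ?rot_cycle ?size_rot.
- by move=> z; rewrite mem_rot.
- by rewrite -(size_rot i) Es /= size_cat addnS.
- by move=> z; rewrite next_rot.
Qed.

Lemma is_cycle_swap x A y B : is_cycle (x :: A ++ y :: B) -> is_cycle (y :: B ++ x :: A).
Proof.
move=> [u c s]; rewrite -cat_cons -(rot_size_cat (x :: A)) cat_cons.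
by split; rewrite ?rot_uniq ?rot_cycle ?size_rot.
Qed.

Lemma arc_path x A y B : is_cycle (x :: A ++ y :: B) ->
  path e x (rcons A y) /\ uniq (x :: rcons A y).
Proof.
move=> [u c _]; split.
  by move: c; rewrite /= rcons_cat cat_path /= => /and3P[pA eA _]; rewrite rcons_path pA.
move: u; rewrite -cat_rcons -cat_cons cat_uniq => /andP[] //.
Qed.

Lemma chord_cycle x A y B : is_cycle (x :: A ++ y :: B) -> e x y -> A != [::] ->
  is_cycle (x :: rcons A y).
Proof.
move=> cD exy A0; have [pA uA] := arc_path cD; split=> //.
  by rewrite /= rcons_path pA last_rcons e_sym.
by rewrite /= size_rcons; case: (A) A0.
Qed.

Lemma detour_cycle w x A y B : is_cycle (x :: A ++ y :: B) ->
  w \notin x :: A ++ y :: B -> e w x -> e w y -> is_cycle (w :: x :: rcons A y).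
Proof.
move=> cD wD ewx ewy; have [pA uA] := arc_path cD; split.
- rewrite cons_uniq uA andbT; apply: contra wD.
  by rewrite -cat_rcons -cat_cons mem_cat => ->.
- by rewrite /= ewx rcons_path pA last_rcons e_sym.
- by rewrite /= size_rcons.
Qed.

Lemma next_rcons_last x A y : uniq (x :: rcons A y) -> next (x :: rcons A y) y = x.
Proof.
rewrite cons_uniq rcons_uniq => /and3P[xA yA _].
rewrite next_nth inE mem_rcons mem_head orbT /=.
have /negPf-> : x != y by apply: contraNneq xA => ->; rewrite mem_rcons mem_head.
by rewrite -cats1 index_cat (negPf yA) /= eqxx addn0 nth_default // size_cat addn1.
Qed.

Lemma shortcuts D x y : is_cycle D -> x \in D -> y \in D -> e x y ->
  ~~ ((y == next D x) || (x == next D y)) ->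
  exists D1 D2, [/\ is_cycle D1, is_cycle D2, {subset D1 <= D}, {subset D2 <= D} &
    size D1 + size D2 = (size D).+2].
Proof.
move=> cD xD yD exy; have [A [B [cD' mD szD nD]]] := cycle_split cD xD yD (edge_neq e_irr exy).
rewrite negb_or !nD => /andP[nx ny].
have A0 : A != [::] by apply: contraNneq nx => ->; rewrite /= eqxx.
have B0 : B != [::].
  apply: contraNneq ny => B0; have [uD' _ _] := cD'.
  by rewrite B0 cats1 next_rcons_last // -cats1 -B0.
exists (x :: rcons A y), (y :: rcons B x); split.
- exact: chord_cycle cD' exy A0.
- by apply: chord_cycle (is_cycle_swap cD') _ B0; rewrite e_sym.
- by move=> z; rewrite mD inE mem_rcons !(in_cons, mem_cat) => /or3P[]->; rewrite ?orbT.
- by move=> z; rewrite mD inE mem_rcons !(in_cons, mem_cat) => /or3P[]->; rewrite ?orbT.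
by rewrite /= !size_rcons szD; lia.
Qed.

Lemma shortest (P : seq T -> Prop) : (exists D, P D) ->
  exists D, P D /\ forall D', P D' -> size D <= size D'.
Proof.
move=> [D0 PD0]; pose Q k := `[< exists D, P D /\ size D = k >].
have exQ : exists k, Q k by exists (size D0); apply/asboolP; exists D0.
case: (ex_minnP exQ) => k /asboolP[D [PD szD]] mink; exists D; split=> // D' PD'.
by rewrite szD; apply: mink; apply/asboolP; exists D'.
Qed.

(** A chord splits the cycle into two shorter ones, whose sizes add up to that of the
    cycle plus 2; if the cycle is odd, so is one of them. *)
Lemma shortest_chordless D : is_cycle D ->
  (forall D', is_cycle D' -> {subset D' <= D} -> (odd (size D) -> odd (size D')) ->
     size D <= size D') -> chordless e D.
Proof.
move=> cD minD x y xD yD exy; apply: contraT => nxy.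
have [D1 [D2 [c1 c2 s1 s2 sz]]] := shortcuts cD xD yD exy nxy.
have [[_ _ sz1] [_ _ sz2]] := (c1, c2).
have [oD1|eD1] := boolP (odd (size D1)).
  by have := minD D1 c1 s1 (fun=> oD1); lia.
have := minD D2 c2 s2; have : odd (size D1 + size D2) = odd (size D) by rewrite sz /= negbK.
rewrite oddD (negPf eD1) /= => -> /(_ id); lia.
Qed.

(** Two neighbours of an outside vertex turn the cycle into a theta graph, and
    [lister_theta] bounds the arcs between them. *)
Lemma lister_two_neighbours D U w x y : ~ lister_wins e (#|U| - 2) U (fun=> 2) ->
  is_cycle D -> {subset D <= U} -> w \in U -> w \notin D ->
  e w x -> e w y -> x \in D -> y \in D -> x != y ->
  exists A B, [/\ is_cycle (x :: A ++ y :: B) /\ D =i x :: A ++ y :: B,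
    size D = (size A + size B).+2, (size A <= 1) || (size B == 0), (size B <= 1) || (size A == 0) &
    is_cycle (w :: x :: rcons A y) /\ is_cycle (w :: y :: rcons B x)].
Proof.
move=> nw cD sD wU wD ewx ewy xD yD xy.
have [A [B [cD' mD szD _]]] := cycle_split cD xD yD xy.
have cD'' := is_cycle_swap cD'.
have mD' z : (z \in y :: B ++ x :: A) = (z \in D).
  by rewrite mD -!cat_cons !mem_cat orbC.
exists A, B; split=> //.
- have [//|A2] := leqP (size A) 1; rewrite eqn0Ngt; apply/negP => B0; apply: nw.
  have [u c _] := cD'.
  by apply: (@lister_theta _ _ e_sym e_irr U w x A y B) => //;
    [move=> z; rewrite -mD => /sD | rewrite -mD].
- have [//|B2] := leqP (size B) 1; rewrite eqn0Ngt; apply/negP => A0; apply: nw.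
  have [u c _] := cD''.
  by apply: (@lister_theta _ _ e_sym e_irr U w y B x A) => //;
    [move=> z; rewrite mD' => /sD | rewrite mD'].
- split; first by apply: detour_cycle cD' _ _ _; rewrite -?mD.
  by apply: detour_cycle cD'' _ _ _; rewrite ?mD'.
Qed.

(** Lister's win with budget [size D] forces [size D] to be at least [n - 1], and
    Painter's win on the bare cycle excludes [n].  If the missing vertex has two
    neighbours, one of the two cycles through it is odd; as [D] is shortest, the
    complementary arc is short, and [lister_two_neighbours] makes [D] a triangle. *)
Lemma odd_cycle_misses_one_vertex D : is_cycle D -> odd (size D) ->
  (forall D', is_cycle D' -> odd (size D') -> size D <= size D') ->
  lister_wins e (#|T| - 1) [set: T] (fun=> 2) ->
  ~ lister_wins e (#|T| - 2) [set: T] (fun=> 2) ->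
  exists w, [/\ chordless e D, size D = #|T|.-1, (forall v, (v \in D) = (v != w)) &
     deg_in e [set: T] w <= 1 \/ #|T| = 4].
Proof.
move=> cD oD minD lw nw; have [uD cycD szD] := cD.
have chD : chordless e D by apply: shortest_chordless => // D' cD' _ /(_ oD); exact: minD.
have cDset : #|[set x in D]| = size D by rewrite cardsE (card_uniqP uD).
have leD : size D <= #|T| by rewrite -cDset max_card.
have geD : #|T|.-1 <= size D.
  rewrite leqNgt; apply/negP => ltD; apply: nw.
  have sD : {subset D <= [set: T]} by move=> z _; rewrite inE.
  by apply: lister_wins_mono (lister_odd_cycle e_irr sD cycD uD oD) => //; lia.
have szDE : size D = #|T|.-1.
  apply/eqP; rewrite eqn_leq geD andbT leqNgt; apply/negP => ltD.
  apply: (painter_odd_cycle e_sym e_irr uD chD (b := #|T| - 1)); first by lia.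
  rewrite (_ : [set x in D] = [set: T]) //; apply/eqP.
  by rewrite eqEcard subsetT cardsT cDset; lia.
have /cards1P[w Ew] : #|~: [set x in D]| == 1.
  by apply/eqP; have := cardsC [set x in D]; rewrite cDset; lia.
have Dw v : (v \in D) = (v != w).
  by have /setP/(_ v) := Ew; rewrite !inE => <-; rewrite negbK.
exists w; split=> //; have [|deg2] := leqP (deg_in e [set: T] w) 1; [by left | right].
have [x [_ ewx _]] := other_neighbour w deg2.
have [y [_ ewy yx]] := other_neighbour x deg2.
have inD v : e w v -> v \in D by move=> ewv; rewrite Dw eq_sym (edge_neq e_irr).
have xy : x != y by rewrite eq_sym.
have [||||A [B [_ szAB hA hB [c1 c2]]]] :=
  @lister_two_neighbours D [set: T] w x y _ cD _ _ _ ewx ewy (inD _ ewx) (inD _ ewy) xy.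
- by rewrite cardsT.
- by move=> z; rewrite inE.
- by rewrite inE.
- by rewrite Dw eqxx.
suff : size D = 3 by rewrite szDE; clear; lia.
have := minD _ c1; have := minD _ c2; move: oD hA hB.
rewrite szAB /= !size_rcons; clear; lia.
Qed.

End Cycles.

(** * Graphs without odd cycles *)

Section Bipartite.

Variables (T : finType) (e : rel T).
Hypotheses (e_sym : symmetric e) (e_irr : irreflexive e).
Implicit Types (U V X W : {set T}) (D A B : seq T).

Local Notation is_cycle := (is_cycle e).

Definition triangle_free := forall u v w, e u v -> e v w -> ~~ e u w.

Lemma two_centred_leaves p q U : triangle_free ->
  (exists2 l, l \in U & l \notin [set p; q]) ->
  {in U :\: [set p; q], forall l, e p l /\ e q l} -> two_centred e p q U.
Proof.
move=> tf [l0 l0U l0c] leaf x y xU yU exy.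
have [e0p e0q] : e p l0 /\ e q l0 by apply: leaf; rewrite inE l0c.
have [xc|xc] := boolP (x \in [set p; q]); have [yc|yc] := boolP (y \in [set p; q]) => //.
  suff : ~~ e x y by rewrite exy.
  by apply: (tf x l0 y); [case/set2P: xc => -> | rewrite e_sym; case/set2P: yc => ->].
have [epx _] : e p x /\ e q x by apply: leaf; rewrite inE xc.
have [epy _] : e p y /\ e q y by apply: leaf; rewrite inE yc.
by have := tf _ _ _ epx exy; rewrite epy.
Qed.

Lemma lister_two_centres m p q U : triangle_free -> p != q -> p \in U -> q \in U ->
  (exists2 l, l \in U & l \notin [set p; q]) ->
  {in U :\: [set p; q], forall l, e p l /\ e q l} ->
  lister_wins e m U (fun=> 2) ->
  4 <= #|U :\: [set p; q]| /\ lister_wins e 5 U (fun=> 2).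
Proof.
move=> tf pq pU qU exl leaf w.
have tc := two_centred_leaves tf exl leaf.
have L4 : 4 <= #|U :\: [set p; q]|.
  by rewrite leqNgt; apply/negP => L3; apply: (painter_K23 e_sym e_irr tc pq L3 w).
split=> //; move: L4; rewrite cardE.
have mL z : z \in enum (U :\: [set p; q]) -> z \in U :\: [set p; q] by rewrite mem_enum.
have := enum_uniq (U :\: [set p; q]).
case: (enum _) mL => [|l1 [|l2 [|l3 [|l4 L]]]] // mL uL _.
have inL z : z \in [:: l1; l2; l3; l4] -> z \in U :\: [set p; q].
  by move=> zl; apply: mL; rewrite -[_ :: _]/([:: l1; l2; l3; l4] ++ L) mem_cat zl.
apply: (@lister_K24 _ _ e_sym e_irr U p q l1 l2 l3 l4).
- move=> z; rewrite inE => /predU1P[->//|]; rewrite inE => /predU1P[->//|/inL].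
  by case/setDP.
- have : uniq [:: l1; l2; l3; l4].
    by move: uL; rewrite -[_ :: _]/([:: l1; l2; l3; l4] ++ L) cat_uniq => /and3P[].
  have nc z c : c \in [set p; q] -> z \in [:: l1; l2; l3; l4] -> c != z.
    by move=> cc /inL/setDP[_ zc]; apply: contraNneq zc => <-.
  rewrite ![uniq (_ :: _ :: _ :: _ :: _)]cons_uniq => ->.
  rewrite !andbT inE negb_or pq /=; apply/andP; split.
    by apply/negP => /nc-/(_ p); rewrite !inE !eqxx => /(_ isT).
  by apply/negP => /nc-/(_ q); rewrite !inE !eqxx orbT => /(_ isT).
- by move=> l /inL; exact: leaf.
Qed.

(** Take [U] minimal among the sets on which Lister wins: [painter_peel] gives the
    degrees, and [painter_union] gives connectedness. *)
Lemma minimal_unpaintable m : lister_wins e m [set: T] (fun=> 2) ->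
  exists U, [/\ lister_wins e m U (fun=> 2),
    (forall v, v \in U -> 2 <= deg_in e U v) &
    forall D, D != [::] -> {subset D <= U} -> forall v, v \in U ->
      exists q, [/\ path e v q, {subset q <= U} & last v q \in D]].
Proof.
move=> w; pose P := [pred U : {set T} | `[< lister_wins e m U (fun=> 2) >]].
have exP : exists U, P U by exists [set: T]; apply/asboolP.
have [U /minsetP[/asboolP wU minU]] := ex_minset exP.
have smaller V : V \proper U -> ~ lister_wins e m V (fun=> 2).
  move=> /properP[sVU [x xU xV]] wV; move: xV; rewrite (minU V) ?xU //.
  exact/asboolP.
exists U; split=> // [v vU|D D0 sD].
  rewrite leqNgt; apply/negP => deg; apply: (painter_peel e_sym e_irr (v := v)) wU => //.
  by apply: smaller; exact: properD1.
pose C := [set v in U | `[< exists q, [/\ path e v q, {subset q <= U} & last v q \in D] >]].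
suff UC : U = C by move=> v; rewrite {1}UC inE => /andP[_ /asboolP].
apply/eqP; rewrite eq_sym; apply: contraT => CU.
have sCU : C \subset U by apply/subsetP => v; rewrite inE => /andP[].
have pC : C \proper U by rewrite properEneq CU.
have [d dD] : exists d, d \in D by case: (D) D0 => // d D' _; exists d; rewrite mem_head.
have dC : d \in C by rewrite inE sD //=; apply/asboolP; exists [::].
have pUC : U :\: C \proper U.
  by apply/properP; split; [exact: subsetDl | exists d; rewrite ?sD // in_setD dC].
have EU : C :|: (U :\: C) = U by rewrite -[RHS](setID U C) (setIidPr sCU).
suff ne : {in C & U :\: C, forall x y, ~~ e x y}.
  by case: (painter_union e_sym e_irr ne (smaller _ pC) (smaller _ pUC)); rewrite EU.
move=> x y; rewrite inE => /andP[xU /asboolP[q [pq sq lq]]] /setDP[yU yC].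
apply/negP => exy; case/negP: yC; rewrite inE yU /=; apply/asboolP; exists (x :: q).
split=> //=; first by rewrite e_sym exy.
by move=> z; rewrite inE => /predU1P[->|/sq].
Qed.

(** Each step rules out [lister_edge_off_cycle], or a consequence of it, on a minimal
    set [U] and a shortest cycle [D] in it; only [K_{2,m}] survives. *)
Lemma bipartite_tight_is_K24 m : (forall D, uniq D -> cycle e D -> ~~ odd (size D)) ->
  lister_wins e m [set: T] (fun=> 2) ->
  ~ lister_wins e (#|T| - 2) [set: T] (fun=> 2) ->
  exists p q, [/\ p != q, #|T| = 6, triangle_free &
    forall l, l \notin [set p; q] -> e p l /\ e q l].
Proof.
move=> noodd /minimal_unpaintable[U [wU deg2 conn]] nwT.
have tf : triangle_free.
  move=> u v w euv evw; apply/negP => euw.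
  have := noodd [:: u; v; w]; rewrite /= !inE negb_or !(edge_neq e_irr) //.
  by rewrite euv evw e_sym euw => /(_ isT isT).
have nw : ~ lister_wins e (#|U| - 2) U (fun=> 2).
  move=> w; apply: nwT; apply: lister_wins_mono w => //.
  by rewrite leq_sub2r // max_card.
have [v0 v0U] : exists v0, v0 \in U.
  have [U0|[v0 v0U]] := set_0Vmem U; last by exists v0.
  have [] : ~ lister_wins e m U (fun=> 2); last exact: wU.
  by apply: painter_independent => [v|x y]; rewrite U0 inE.
have [D [[cD sD] minD]] := shortest (exists_cycle e_irr v0U deg2).
have [uD cycD szD] := cD.
have eD := noodd D uD cycD.
have D4 : 4 <= size D by move: szD eD; clear; lia.
have chD : chordless e D.
  by apply: (shortest_chordless e_sym e_irr) => // D' cD' sD' _; apply: minD; split=> // z /sD'/sD.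
have D0 : D != [::] by case: (D) szD.
have off a b : a \in U -> b \in U -> a \notin D -> b \notin D -> ~~ e a b.
  move=> aU bU aD bD; apply/negP => eab; apply: nw.
  exact: (lister_edge_outside_cycle e_sym e_irr deg2 (conn D D0 sD) sD cD D4 aU bU).
have [sUD|/subsetPn[w wU' wD]] := boolP (U \subset [set x in D]).
  case: (painter_even_cycle e_sym e_irr (b := m) uD chD eD).
  exact: lister_wins_mono wU.
rewrite inE in wD.
(* Two neighbours of an outside vertex cut the cycle into two arcs of length 2. *)
have [x [y [xD yD xy [ewx ewy] [a [b [cD4 mD]]]]]] : exists x y,
    [/\ x \in D, y \in D, x != y, e w x /\ e w y &
     exists a b, is_cycle [:: x; a; y; b] /\ D =i [:: x; a; y; b]].
  have [x [xU ewx _]] := other_neighbour w (deg2 w wU').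
  have [y [yU ewy yx]] := other_neighbour x (deg2 w wU').
  have inD z : z \in U -> e w z -> z \in D.
    by move=> zU ewz; apply: contraT => zD; have := off w z wU' zU wD zD; rewrite ewz.
  have xy : x != y by rewrite eq_sym.
  have [A [B [[cD' mD] szAB hA hB [c1 c2]]]] :=
    lister_two_neighbours e_sym e_irr nw cD sD wU' wD ewx ewy (inD _ xU ewx) (inD _ yU ewy) xy.
  have oA : odd (size A).
    by have [u c _] := c1; have := noodd _ u c; rewrite /= size_rcons /= !negbK.
  have oB : odd (size B).
    by have [u c _] := c2; have := noodd _ u c; rewrite /= size_rcons /= !negbK.
  have [A1 B1] : size A = 1 /\ size B = 1 by move: oA oB hA hB; clear; lia.
  exists x, y; split; rewrite ?inD //.
  by case: A A1 B B1 {oA oB hA hB c1 c2 szAB} cD' mD => [|a []] // _ [|b []] // _; exists a, b.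
have [uD4 cycD4 _] := cD4.
move: cycD4 => /= /and5P[exa eay eyb ebx _].
have out c : c \in U -> c \notin D -> e c x /\ e c y \/ e c a /\ e c b.
  move=> cU cD'.
  have inD z : z \in U -> e c z -> z \in D.
    by move=> zU ecz; apply: contraT => zD; have := off c z cU zU cD' zD; rewrite ecz.
  have [z1 [z1U ecz1 _]] := other_neighbour c (deg2 c cU).
  have [z2 [z2U ecz2 z21]] := other_neighbour z1 (deg2 c cU).
  have := inD _ z1U ecz1; have := inD _ z2U ecz2.
  have tri u v : e u v -> e c u -> e c v -> False.
    by move=> euv ecu ecv; have := tf c u v ecu euv; rewrite ecv.
  rewrite !mD !inE => /or4P[]/eqP E2 /or4P[]/eqP E1; rewrite ?E1 ?E2 in z21 ecz1 ecz2;
    try (by rewrite eqxx in z21); try (by left); try (by right);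
    by [case: (tri _ _ exa) | case: (tri _ _ eay) | case: (tri _ _ eyb) | case: (tri _ _ ebx)].
have [xy' xa xb] : [/\ x != y, x != a & x != b].
  by move: uD4; rewrite /= !inE !negb_or => /and3P[/and3P[-> -> ->]].
have inDU z : z \in [:: x; a; y; b] -> z \in U by rewrite -mD; exact: sD.
(* An outside vertex [l] attached to [a] and [b] would put the edge [w x] off the
   4-cycle [y a l b]. *)
have leaf : {in U :\: [set x; y], forall l, e x l /\ e y l}.
  move=> l; rewrite !inE negb_or => /andP[/andP[lx ly] lU].
  have [lD|lD] := boolP (l \in D).
    move: lD; rewrite mD !inE (negPf lx) (negPf ly) /=.
    by case/orP => /eqP->; split; rewrite // e_sym.
  case: (out l lU lD) => -[]; rewrite ![e l _]e_sym // => eal ebl.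
  case: nw; have lw : l != w.
    apply: contraTneq eal => ->; apply: contraT; rewrite negbK => eaw.
    by have := tf _ _ _ exa eaw; rewrite e_sym ewx.
  have nD z : z \in [:: x; a; y; b] -> w != z /\ l != z.
    by rewrite -mD => zD; split; [apply: contraNneq wD | apply: contraNneq lD] => ->.
  have [wx _] := nD x (mem_head _ _).
  have [[wa la] [wy _] [wb lb]] : [/\ w != a /\ l != a, w != y /\ l != y & w != b /\ l != b].
    by split; apply: nD; rewrite !inE eqxx ?orbT.
  apply: (@lister_edge_off_cycle _ _ e_sym e_irr U w x [:: y; a; l; b] [:: y] [:: a]) => //.
  - by apply: inDU; rewrite inE eqxx.
  - move=> z; rewrite !inE => /or4P[]/eqP-> //; apply: inDU; by rewrite !inE eqxx ?orbT.
  - by rewrite /= e_sym eay eal e_sym ebl e_sym eyb.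
  - move: uD4; rewrite /= !inE !negb_or !andbT => /and3P[_ /andP[ay ab] yb].
    by rewrite [y == a]eq_sym ay [y == l]eq_sym ly yb [a == l]eq_sym la ab lb.
  - by rewrite !inE !negb_or wy wa wb eq_sym lw.
  - by rewrite !inE !negb_or xy' xa xb eq_sym lx.
  - by rewrite /= ewy.
  - by move=> z; rewrite !inE => /eqP->; rewrite eq_sym xy' inDU // !inE eqxx ?orbT.
  - by rewrite mem_head.
  - by rewrite /= exa.
  - by move=> z; rewrite !inE => /eqP->; rewrite eq_sym wa inDU // !inE eqxx ?orbT.
  - by rewrite !inE eqxx orbT.
have exl : exists2 l, l \in U & l \notin [set x; y].
  by exists w => //; rewrite !inE negb_or; apply/andP; split; apply: contraNneq wD => ->.
have [L4 w5] := lister_two_centres tf xy (sD _ xD) (sD _ yD) exl leaf wU.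
have cU : 6 <= #|U|.
  have /setIidPr : [set x; y] \subset U by apply/subsetP => z /set2P[]->; exact: sD.
  move=> E; have := cardsID [set x; y] U; rewrite E cards2 xy; move: L4; clear; lia.
have cT : #|T| <= 6.
  rewrite leqNgt; apply/negP => T7; apply: nwT.
  by apply: lister_wins_mono w5 => //; move: T7; clear; lia.
have UT : U = [set: T].
  by apply/eqP; rewrite eqEcard subsetT cardsT (leq_trans cT).
exists x, y; split=> //; last by move=> l lc; apply: leaf; rewrite inE lc UT inE.
by apply/eqP; rewrite eqn_leq cT (leq_trans cU) ?max_card.
Qed.

End Bipartite.

(** * The value of M and the extremal graphs *)

Section MValue.

Variables (T : finType) (e : rel T).
Hypotheses (e_sym : symmetric e) (e_irr : irreflexive e).
Local Notation n := #|T|.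

Lemma sum_two_tokens : \sum_(v : T) 2 = n * 2.
Proof. by rewrite sum_nat_const. Qed.

Lemma unpaintable_lister_wins : ~ paintable e (fun=> 2) ->
  lister_wins e (n * 2) [set: T] (fun=> 2).
Proof.
move=> np; apply: contrapT => nw; apply: np.
by apply: (painter_unbounded e_irr _ nw); rewrite sum_two_tokens.
Qed.

(** With [n] vertices and two tokens each, [n + 1] rounds mean an excess of [n - 1],
    and more rounds mean an excess of at most [n - 2]. *)
Lemma is_M_budget : 1 < n -> is_M e n.+1 <->
  lister_wins e (n - 1) [set: T] (fun=> 2) /\
  ~ lister_wins e (n - 2) [set: T] (fun=> 2).
Proof.
move=> n1; split=> [[npM maxM]|[w nw]].
  split.
    apply: contrapT => nw; apply: npM; apply: (painter_in e_irr _ nw).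
    by rewrite sum_two_tokens; move: n1; clear; lia.
  move=> w; have := maxM n.+2; rewrite ltnn => H; apply: notF; apply: H.
  apply: (lister_in _ _ _ w) => //; first by rewrite sum_two_tokens; move: n1; clear; lia.
  by move: n1; clear; lia.
split.
  apply: (lister_in _ _ _ w) => //; first by rewrite sum_two_tokens; move: n1; clear; lia.
  by move: n1; clear; lia.
move=> t npt; rewrite leqNgt; apply/negP => lt_t; apply: npt.
apply: (painter_in e_irr _ nw).
by rewrite sum_two_tokens; move: n1 lt_t; clear; lia.
Qed.

End MValue.

Section CyclesAsCores.

Variables (T : finType) (e : rel T).
Hypotheses (e_sym : symmetric e) (e_irr : irreflexive e).
Implicit Types (S : {set T}) (D : seq T).

Lemma deg_in_cycle D v : is_cycle e D -> v \in D -> 2 <= deg_in e [set x in D] v.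
Proof.
move=> [uD cD szD] vD; case/rot_to: (vD) => i s Es.
have mD z : (z \in D) = (z \in v :: s) by rewrite -Es mem_rot.
have {}uD : uniq (v :: s) by rewrite -Es rot_uniq.
have {}cD : cycle e (v :: s) by rewrite -Es rot_cycle.
have {}szD : 2 < size (v :: s) by rewrite -Es size_rot.
case: s {Es} mD uD cD szD => [|y s] //; case/lastP: s => [|s z] // mD uD cD _.
have yz : y != z.
  move: uD; rewrite !cons_uniq => /and3P[_ ys _].
  by apply: contraNneq ys => ->; rewrite mem_rcons mem_head.
have [evy ezv] : e v y /\ e z v.
  by move: cD; rewrite /= !rcons_path last_rcons => /and3P[-> _ ->].
rewrite (_ : 2 = #|[set y; z]|); last by rewrite cards2 yz.
apply: subset_leq_card; apply/subsetP => x /set2P[]->; rewrite !inE mD.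
  by rewrite !inE eqxx orbT evy.
by rewrite !in_cons mem_rcons mem_head !orbT e_sym ezv.
Qed.

(** The vertices of the cycle have degree at least 2 within it, so they survive every
    step; the fate of [w] is decided in the first step. *)
Lemma core_cycle D w : is_cycle e D -> (forall v, (v \in D) = (v != w)) ->
  core e = if deg_in e [set: T] w <= 1 then [set x in D] else [set: T].
Proof.
move=> cD Dw; rewrite /core; set F := fun S => _.
have degD v : v \in D -> 1 < deg_in e [set x in D] v by exact: deg_in_cycle.
have degT v : v \in D -> 1 < deg_in e [set: T] v.
  by move=> /degD/leq_trans; apply; apply: deg_in_mono; exact: subsetT.
have wD : w \notin D by rewrite Dw eqxx.
case: leqP => [w1|w2].
  have F1 : F [set: T] = [set x in D].
    apply/setP => v; rewrite !inE /=; have [vD|] := boolP (v \in D); first exact: degT.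
    by rewrite Dw negbK => /eqP->; rewrite ltnNge w1.
  have F2 : F [set x in D] = [set x in D].
    by apply/setP => v; rewrite !inE; have [/degD|] := boolP (v \in D).
  have : 0 < #|T| by apply/card_gt0P; exists w.
  by case: #|T| => // k _; rewrite iterSr F1 iter_fix.
rewrite iter_fix //; apply/setP => v; rewrite !inE /=.
by have [/degT|] := boolP (v \in D); rewrite // Dw negbK => /eqP->.
Qed.

Lemma iso_cycle_graph D S k : is_cycle e D -> chordless e D -> size D = k ->
  S = [set x in D] -> graph_iso (@induced T e S) (@cycle_graph k).
Proof.
move=> [uD cD szD] chD szDk ES.
have inD (x : {x | x \in S}) : val x \in D.
  by have /setP/(_ (val x)) := ES; rewrite inE => <-; exact: valP.
have lt_k (x : {x | x \in S}) : index (val x) D < k by rewrite -szDk index_mem.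
pose h x := Ordinal (lt_k x).
have h_inj : injective h.
  move=> x y hxy; apply: val_inj; have E : index (val x) D = index (val y) D.
    exact: (congr1 (@nat_of_ord k) hxy).
  by rewrite -(nth_index (val x) (inD x)) E nth_index ?inD.
exists h.
  apply: inj_card_bij => //; rewrite card_ord card_sig.
  by rewrite (eq_card (B := [set x in D])) ?cardsE ?(card_uniqP uD) ?szDk // => x; rewrite ES.
have hE x y : (ordS (h x) == h y) = (next D (val x) == val y).
  rewrite -val_eqE /= -szDk -index_next ?inD //; apply/eqP/eqP => [|->//].
  move=> E; have nD : next D (val x) \in D by rewrite mem_next inD.
  by rewrite -(nth_index (val x) nD) E nth_index ?inD.
move=> x y; rewrite /cycle_graph !hE /induced; apply/idP/idP.
  by case/orP => /eqP <-; [|rewrite e_sym]; apply: next_cycle.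
by move/(chD _ _ (inD x) (inD y))/orP => -[/eqP <-|/eqP <-]; rewrite eqxx ?orbT.
Qed.

Lemma cycle_graph_iso S k : 2 < k ->
  graph_iso (@induced T e S) (@cycle_graph k) ->
  exists D, [/\ is_cycle e D, chordless e D, size D = k & S = [set x in D]].
Proof.
case: k => // k k2 [h [g gK hK] h_mono].
have g_mono i j : e (val (g i)) (val (g j)) = cycle_graph i j.
  by rewrite -[LHS]/(@induced T e S (g i) (g j)) -h_mono !hK.
pose F i := val (g (inord i)); pose D := mkseq F k.+1.
have F_inj i j : i < k.+1 -> j < k.+1 -> F i = F j -> i = j.
  move=> ik jk /val_inj/(can_inj hK)/(congr1 (@nat_of_ord k.+1)).
  by rewrite !inordK.
have szD : size D = k.+1 by rewrite size_mkseq.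
have uD : uniq D.
  rewrite map_inj_in_uniq ?iota_uniq // => i j; rewrite !mem_iota !add0n /=.
  exact: F_inj.
have idx i : i < k.+1 -> index (F i) D = i.
  by move=> ik; rewrite -{1}(nth_mkseq (F 0) F ik) index_uniq ?szD.
have FD i : i < k.+1 -> F i \in D.
  by move=> ik; apply/mapP; exists i; rewrite // mem_iota.
have nextF i : i < k.+1 -> next D (F i) = F (i.+1 %% k.+1).
  move=> ik; have nD : next D (F i) \in D by rewrite mem_next FD.
  rewrite -(nth_index (F 0) nD) index_next ?FD // idx // szD nth_mkseq //.
  exact: ltn_pmod.
have FS x : x \in D -> exists2 i : 'I_k.+1, x = F i & val i < k.+1.
  case/mapP => i; rewrite mem_iota add0n /= => ik ->.
  by exists (Ordinal ik).
have eF (i j : 'I_k.+1) : e (F i) (F j) = cycle_graph i j.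
  by rewrite /F g_mono !inord_val.
exists D; split=> //.
- split; rewrite ?szD //; apply: (cycle_from_next uD) => x /FS[i -> ik].
  rewrite nextF // -[_ %% _]/(val (ordS i)) eF /cycle_graph eqxx //.
- move=> x y /FS[i -> ik] /FS[j -> jk]; rewrite eF !nextF // /cycle_graph.
  by case/orP => /eqP <-; rewrite eqxx ?orbT.
apply/setP => x; rewrite inE; apply/idP/idP => [xS|/FS[i -> _]]; last exact: valP.
have -> : x = F (h (Sub x xS)) by rewrite /F inord_val gK.
exact: FD.
Qed.

End CyclesAsCores.

Lemma graph_iso_sym (T1 T2 : finType) (e1 : rel T1) (e2 : rel T2) :
  graph_iso e1 e2 -> graph_iso e2 e1.
Proof.
by move=> [h [g hK gK] h_mono]; exists g => [|x y]; [exists h | rewrite -h_mono !gK].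
Qed.

Section CompleteBipartite.

Variables (T : finType) (e : rel T).
Hypotheses (e_sym : symmetric e) (e_irr : irreflexive e).

Lemma K24_iso p q : p != q -> #|T| = 6 -> triangle_free e ->
  (forall l, l \notin [set p; q] -> e p l /\ e q l) ->
  graph_iso e (@complete_bipartite 2 4).
Proof.
move=> pq T6 tf leaf; apply: graph_iso_sym.
have cL : #|~: [set p; q]| = 4 by have := cardsC [set p; q]; rewrite cards2 pq T6; lia.
have Lp (j : 'I_4) : enum_val (cast_ord (esym cL) j) \notin [set p; q].
  by have := enum_valP (cast_ord (esym cL) j); rewrite inE.
pose g (u : 'I_2 + 'I_4) := match u with
  | inl i => if i == ord0 then p else q
  | inr j => enum_val (cast_ord (esym cL) j) end.
have gc (i : 'I_2) : g (inl i) \in [set p; q] by rewrite /= !inE; case: ifP; rewrite eqxx ?orbT.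
have g_inj : injective g.
  move=> [i|j] [i'|j'] E.
  - have {E} : (i == ord0) = (i' == ord0).
      by move: E => /=; case: (i == ord0); case: (i' == ord0) => // E; move: pq; rewrite E eqxx.
    move: i i' => [[|[|//]] ?] [[|[|//]] ?] // _; congr inl; exact: val_inj.
  - by have := Lp j'; rewrite -[enum_val _]/(g (inr j')) -E gc.
  - by have := Lp j; rewrite -[enum_val _]/(g (inr j)) E gc.
  - by congr inr; move: E => /enum_val_inj/cast_ord_inj.
exists g; first by apply: inj_card_bij; rewrite // card_sum !card_ord T6.
have el c l : c \in [set p; q] -> l \notin [set p; q] -> e c l.
  by move=> + /leaf[epl eql] => /set2P[]->.
have l0 := Lp ord0.
move=> [i|j] [i'|j']; rewrite /complete_bipartite.
- apply/negbTE; apply: (tf _ (enum_val (cast_ord (esym cL) ord0))); first exact: el (gc i) l0.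
  by rewrite e_sym; exact: el (gc i') l0.
- exact: el (gc i) (Lp j').
- by rewrite e_sym; exact: el (gc i') (Lp j).
- have pc : p \in [set p; q] by rewrite !inE eqxx.
  apply/negbTE; apply: (tf _ p); last exact: el pc (Lp j').
  by rewrite e_sym; exact: el pc (Lp j).
Qed.

Lemma K24_budget : graph_iso e (@complete_bipartite 2 4) ->
  [/\ #|T| = 6, lister_wins e 5 [set: T] (fun=> 2) & ~ lister_wins e 4 [set: T] (fun=> 2)].
Proof.
move=> [h [g hK gK] h_mono].
have T6 : #|T| = 6.
  by rewrite (bij_eq_card (Bijective hK gK)) card_sum !card_ord.
pose a := g (inl ord0); pose b := g (inl (@Ordinal 2 1 isT)).
have g_inj : injective g := can_inj gK.
have eg u v : e (g u) (g v) = complete_bipartite u v by rewrite -h_mono !gK.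
have centre u : (g u \in [set a; b]) = if u is inl _ then true else false.
  rewrite !inE !(inj_eq g_inj); by case: u => [[[|[|//]] i]|j].
split=> //.
  pose o k (lt_k : k < 4) : 'I_2 + 'I_4 := inr (Ordinal lt_k).
  apply: (@lister_K24 _ _ e_sym e_irr [set: T] a b
    (g (o 0 isT)) (g (o 1 isT)) (g (o 2 isT)) (g (o 3 isT))).
  - by move=> x; rewrite !inE.
  - exact: (etrans (map_inj_uniq g_inj [:: inl ord0; inl (@Ordinal 2 1 isT);
        o 0 isT; o 1 isT; o 2 isT; o 3 isT])).
  - by move=> x; rewrite !inE => /or4P[]/eqP->; rewrite !eg.
have ab : a != b by rewrite (inj_eq g_inj).
apply: (@painter_K24 _ _ e_sym e_irr a b).
- move=> x y _ _; rewrite -(hK x) -(hK y) eg !centre.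
  by case: (h x) => ?; case: (h y).
- by [].
- by have := cardsC [set a; b]; rewrite setTD cards2 ab T6; clear; lia.
Qed.

End CompleteBipartite.

Section Triangles.

Variables (T : finType) (e : rel T).
Hypotheses (e_sym : symmetric e) (e_irr : irreflexive e).

Lemma triangle_subgraph D : is_cycle e D -> size D = 3 -> is_subgraph (@cycle_graph 3) e.
Proof.
move=> [uD cD _] szD; case: D szD uD cD => [|x [|y [|z []]]] // _ uD /=.
move=> /and4P[exy eyz ezx _].
exists (fun i : 'I_3 => nth x [:: x; y; z] i).
  move=> i j /eqP; rewrite nth_uniq // => /eqP; exact: val_inj.
by case=> [[|[|[|//]]] i] [[|[|[|//]]] j] //= _; rewrite ?exy ?eyz ?ezx // e_sym.
Qed.

Lemma triangle_lister_wins : is_subgraph (@cycle_graph 3) e ->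
  lister_wins e 3 [set: T] (fun=> 2).
Proof.
move=> [h h_inj h_homo].
pose c : seq 'I_3 := [:: @Ordinal 3 0 isT; @Ordinal 3 1 isT; @Ordinal 3 2 isT].
apply: (@lister_odd_cycle _ _ e_irr [set: T] (map h c)) => //.
- by move=> x _; rewrite inE.
- by rewrite /= !h_homo.
- by rewrite map_inj_uniq.
Qed.

End Triangles.

Theorem theorem27 (T : finType) (e : rel T) (n : nat)
    (e_sym : symmetric e) (e_irr : irreflexive e)
    (card_T : #|T| = n) (not_2_paintable : ~ paintable e (fun=> 2)) :
  is_M e n.+1 <->
  [\/ graph_iso e (@complete_bipartite 2 4),
      n = 4 /\ is_subgraph (@cycle_graph 3) e
    | [/\ odd n.-1, 3 <= n.-1 &
          graph_iso (@induced T e (core e)) (@cycle_graph n.-1)]].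
Proof.
subst n; have wT := unpaintable_lister_wins e_irr not_2_paintable.
have budget3 b : lister_wins e b [set: T] (fun=> 2) -> 3 <= b.
  move=> w; rewrite leqNgt; apply/negP => b2.
  by apply: (painter_budget2 (U := [set: T]) e_irr); apply: lister_wins_mono w.
have n1 : 1 < #|T| by have := budget3 _ wT; clear; lia.
rewrite (is_M_budget e_irr n1); split=> [[w nw]|].
  have [[D0 [uD0 cD0 oD0]]|noodd] :=
      pselect (exists D, [/\ uniq D, cycle e D & odd (size D)]); last first.
    have [|p [q [pq T6 tf leaf]]] := bipartite_tight_is_K24 e_sym e_irr _ wT nw.
      by move=> D uD cD; apply/negP => oD; apply: noodd; exists D.
    by constructor 1; apply: (K24_iso e_sym pq).
  have [D [[cD oD] minD]] : exists D, (is_cycle e D /\ odd (size D)) /\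
      forall D', is_cycle e D' /\ odd (size D') -> size D <= size D'.
    by apply: shortest; exists D0; split=> //; apply: odd_is_cycle.
  have [|w0 [chD szD Dw]] := odd_cycle_misses_one_vertex e_sym e_irr cD oD _ w nw.
    by move=> D' cD' oD'; apply: minD.
  move=> w0_deg; have [T4|T4] := eqVneq #|T| 4.
    constructor 2; split=> //; apply: triangle_subgraph cD _ => //.
    by rewrite szD T4.
  constructor 3; have [_ _ szD3] := cD; rewrite -szD; split=> //.
  apply: (iso_cycle_graph e_sym cD chD erefl); rewrite (core_cycle e_sym cD Dw).
  by case: w0_deg => [->|/eqP]; rewrite ?(negPf T4).
case=> [/(K24_budget e_sym e_irr)[T6 w nw]|[T4 tri]|[oT T3 iso]].
- by rewrite T6.
- rewrite T4; split; [exact: triangle_lister_wins | exact: painter_budget2].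
have [D [cD chD szD coreE]] := cycle_graph_iso T3 iso.
have [uD cycD _] := cD.
have cDset : #|[set x in D]| = #|T|.-1 by rewrite cardsE (card_uniqP uD).
have /cards1P[w Ew] : #|~: [set x in D]| == 1.
  by apply/eqP; have := cardsC [set x in D]; rewrite cDset; move: n1; clear; lia.
have Dw v : (v \in D) = (v != w).
  by have /setP/(_ v) := Ew; rewrite !inE => <-; rewrite negbK.
have w_deg : deg_in e [set: T] w <= 1.
  move: coreE; rewrite (core_cycle e_sym cD Dw); case: ifP => // _ /setP/(_ w).
  by rewrite !inE Dw eqxx.
split.
  have sD : {subset D <= [set: T]} by move=> x _; rewrite inE.
  by rewrite subn1 -szD; apply: lister_odd_cycle; rewrite ?szD.
apply: (painter_peel e_sym e_irr (v := w)) => //.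
rewrite (_ : [set: T] :\ w = [set x in D]).
  by apply: painter_odd_cycle; rewrite // szD; move: n1; clear; lia.
by apply/setP => x; rewrite !inE Dw andbT.
Qed.
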